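(* Consider the discrete memoryless state-dependent multiaccess channel with degraded message sets described in the context. Let $\mathcal P$ be the set of joint distributions of $(S,U_1,U_2,X_1,X_2,Y)$ of the form $$P_{S,U_1,U_2,X_1,X_2,Y}=Q_S\,P_{U_1}\,P_{X_1|U_1}\,P_{U_2|U_1,S}\,P_{X_2|U_1,U_2,S}\,W_{Y|X_1,X_2,S}$$ which satisfy $I(U_2;Y|U_1,X_1)-I(U_2;S|U_1)>0$, where $U_1\in\mathcal U_1$, $U_2\in\mathcal U_2$ are auxiliary random variables on finite alphabets with $|\mathcal U_1|\le |\mathcal S||\mathcal X_1||\mathcal X_2|+2$ and $|\mathcal U_2|\le (|\mathcal S||\mathcal X_1||\mathcal X_2|+2)|\mathcal S||\mathcal X_1||\mathcal X_2|+2$. Then the capacity region $\mathcal C$ contains the closure of the set of all rate pairs $(R_c,R_1)$ for which there is a distribution in $\mathcal P$ such that $$R_1< I(X_1;Y|U_1,U_2),\qquad R_1< I(X_1,U_2;Y|U_1)-I(U_2;S|U_1),$$ $$R_c+R_1< I(X_1,U_1,U_2;Y)-I(U_2;S|U_1).$$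
   Context: Finite alphabets $\mathcal S,\mathcal X_1,\mathcal X_2,\mathcal Y$. The channel is memoryless with transition law $W_{Y|X_1,X_2,S}$: for length-$n$ sequences, $P(y^n|x_1^n,x_2^n,s^n)=\prod_{i=1}^n W_{Y|X_1,X_2,S}(y_i|x_{1,i},x_{2,i},s_i)$. The state sequence $S^n$ is i.i.d. with law $Q_S$. Two independent messages, uniformly distributed and independent of $S^n$: a common message $W_c\in\{1,\dots,2^{nR_c}\}$ and an individual message $W_1\in\{1,\dots,2^{nR_1}\}$. A $(2^{nR_c},2^{nR_1},n)$-code consists of an encoder $\phi_1^n:\mathcal W_c\times\mathcal W_1\to\mathcal X_1^n$ at the ''uninformed'' encoder (which does not know the state), an encoder $\phi_2^n:\mathcal S^n\times\mathcal W_c\to\mathcal X_2^n$ at the ''informed'' encoder (which knows the whole state sequence $S^n$ non-causally and only the common message), and a decoder $\psi^n:\mathcal Y^n\to\mathcal W_c\times\mathcal W_1$; the decoder does not know the state. The error probability is $P_e^n=\Pr[\psi^n(Y^n)\ne(W_c,W_1)]$. A pair $(R_c,R_1)$ is achievable if there is a sequence of such codes with $P_e^n\to0$; the capacity region $\mathcal C$ is the closure of the set of achievable pairs. *)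

(* Defs.v *)
From Stdlib Require Import Reals.
From mathcomp Require Import ssreflect ssrfun ssrbool eqtype ssrnat seq choice.
From mathcomp Require Import fintype finfun bigop.

Set Implicit Arguments.
Unset Strict Implicit.
Unset Printing Implicit Defensive.

Open Scope R_scope.

Definition rsum (T : finType) (f : T -> R) : R := \big[Rplus/0]_(x : T) f x.

Definition is_pmf (T : finType) (p : T -> R) : Prop :=
  (forall x, 0 <= p x) /\ rsum p = 1.

Definition is_channel (A B : finType) (w : A -> B -> R) : Prop :=
  forall a, is_pmf (w a).

Definition log2 (x : R) : R := ln x / ln 2.

Definition marg (T A : finType) (p : T -> R) (f : T -> A) (a : A) : R :=
  \big[Rplus/0]_(t : T | f t == a) p t.

(** Conditional mutual information I(A;B|C) (in bits) of the random variables
    fa(T), fb(T), fc(T) where T ~ p, with the convention 0 log(...) = 0. *)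
Definition cmi (T A B C : finType) (p : T -> R)
    (fa : T -> A) (fb : T -> B) (fc : T -> C) : R :=
  rsum (fun abc : A * B * C =>
    let '(a, b, c) := abc in
    let pabc := marg p (fun t => (fa t, fb t, fc t)) (a, b, c) in
    if Req_EM_T pabc 0 then 0
    else pabc * log2 (pabc * marg p fc c /
                      (marg p (fun t => (fa t, fc t)) (a, c) *
                       marg p (fun t => (fb t, fc t)) (b, c)))).

Definition mi (T A B : finType) (p : T -> R) (fa : T -> A) (fb : T -> B) : R :=
  cmi p fa fb (fun _ => tt).

Definition joint (S U1 U2 X1 X2 Y : finType)
    (QS : S -> R) (PU1 : U1 -> R) (PX1 : U1 -> X1 -> R)
    (PU2 : U1 -> S -> U2 -> R) (PX2 : U1 -> U2 -> S -> X2 -> R)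
    (W : X1 -> X2 -> S -> Y -> R) : (S * U1 * U2 * X1 * X2 * Y)%type -> R :=
  fun t => let '(s, u1, u2, x1, x2, y) := t in
    QS s * PU1 u1 * PX1 u1 x1 * PU2 u1 s u2 * PX2 u1 u2 s x2 * W x1 x2 s y.

Section Proj.
Context (S U1 U2 X1 X2 Y : finType).
Definition pS  (t : (S * U1 * U2 * X1 * X2 * Y)%type) : S  := t.1.1.1.1.1.
Definition pU1 (t : (S * U1 * U2 * X1 * X2 * Y)%type) : U1 := t.1.1.1.1.2.
Definition pU2 (t : (S * U1 * U2 * X1 * X2 * Y)%type) : U2 := t.1.1.1.2.
Definition pX1 (t : (S * U1 * U2 * X1 * X2 * Y)%type) : X1 := t.1.1.2.
Definition pX2 (t : (S * U1 * U2 * X1 * X2 * Y)%type) : X2 := t.1.2.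
Definition pY  (t : (S * U1 * U2 * X1 * X2 * Y)%type) : Y  := t.2.
End Proj.

Definition inner_region (S X1 X2 Y : finType) (QS : S -> R)
    (W : X1 -> X2 -> S -> Y -> R) (r : R * R) : Prop :=
  let Rc := fst r in let R1 := snd r in
  0 <= Rc /\ 0 <= R1 /\
  exists (U1 U2 : finType) (PU1 : U1 -> R) (PX1 : U1 -> X1 -> R)
         (PU2 : U1 -> S -> U2 -> R) (PX2 : U1 -> U2 -> S -> X2 -> R),
    (#|U1| <= #|S| * #|X1| * #|X2| + 2)%N /\
    (#|U2| <= (#|S| * #|X1| * #|X2| + 2) * (#|S| * #|X1| * #|X2|) + 2)%N /\
    is_pmf PU1 /\ is_channel PX1 /\
    (forall u1, is_channel (PU2 u1)) /\
    (forall u1 u2, is_channel (PX2 u1 u2)) /\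
    let p := joint QS PU1 PX1 PU2 PX2 W in
    let I_U2S_U1 := cmi p (@pU2 S U1 U2 X1 X2 Y) (@pS S U1 U2 X1 X2 Y)
                          (@pU1 S U1 U2 X1 X2 Y) in
    cmi p (@pU2 S U1 U2 X1 X2 Y) (@pY S U1 U2 X1 X2 Y)
          (fun t => (pU1 t, pX1 t)) - I_U2S_U1 > 0 /\
    R1 < cmi p (@pX1 S U1 U2 X1 X2 Y) (@pY S U1 U2 X1 X2 Y)
               (fun t => (pU1 t, pU2 t)) /\
    R1 < cmi p (fun t => (pX1 t, pU2 t)) (@pY S U1 U2 X1 X2 Y)
               (@pU1 S U1 U2 X1 X2 Y) - I_U2S_U1 /\
    Rc + R1 < mi p (fun t => (pX1 t, pU1 t, pU2 t)) (@pY S U1 U2 X1 X2 Y)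
              - I_U2S_U1.

Record code (S X1 X2 Y : finType) (n Mc M1 : nat) := Code {
  enc1 : 'I_Mc -> 'I_M1 -> {ffun 'I_n -> X1};
  enc2 : {ffun 'I_n -> S} -> 'I_Mc -> {ffun 'I_n -> X2};
  dec  : {ffun 'I_n -> Y} -> ('I_Mc * 'I_M1)%type
}.

Definition err_prob (S X1 X2 Y : finType) (QS : S -> R)
    (W : X1 -> X2 -> S -> Y -> R) (n Mc M1 : nat)
    (c : code S X1 X2 Y n Mc M1) : R :=
  rsum (fun wc : 'I_Mc => rsum (fun w1 : 'I_M1 =>
  rsum (fun sn : {ffun 'I_n -> S} => rsum (fun yn : {ffun 'I_n -> Y} =>
    / INR (Mc * M1) *
    (\big[Rmult/1]_(i < n) QS (sn i)) *
    (\big[Rmult/1]_(i < n)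
        W (enc1 c wc w1 i) (enc2 c sn wc i) (sn i) (yn i)) *
    (if dec c yn == (wc, w1) then 0 else 1))))).

(** Number of messages of rate Rt at blocklength n: ceil(2^(n Rt)). *)
Definition nmsg (Rt : R) (n : nat) : nat :=
  Z.to_nat (- Int_part (- Rpower 2 (INR n * Rt))).

Definition achievable (S X1 X2 Y : finType) (QS : S -> R)
    (W : X1 -> X2 -> S -> Y -> R) (r : R * R) : Prop :=
  exists codes : forall n : nat, code S X1 X2 Y n (nmsg (fst r) n) (nmsg (snd r) n),
    Un_cv (fun n => err_prob QS W (codes n)) 0.

Definition closure2 (A : R * R -> Prop) (r : R * R) : Prop :=
  forall eps, 0 < eps -> exists r', A r' /\
    Rabs (fst r - fst r') < eps /\ Rabs (snd r - snd r') < eps.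

Definition capacity_region (S X1 X2 Y : finType) (QS : S -> R)
    (W : X1 -> X2 -> S -> Y -> R) : R * R -> Prop :=
  closure2 (achievable QS W).

(* Main.v *)
Require Import Defs.
From Stdlib Require Import Reals ZArith.
From mathcomp Require Import all_boot all_order all_algebra.
From mathcomp Require Import ring lra.
From mathcomp Require Import boolp Rstruct.

(** Random coding in one shot, without typical sequences.

    A cloud is a symbol [u1], a list of symbols [u2] and a list of symbols [x1],
    the two lists being conditionally independent given [u1]; the common message
    selects a cloud, the individual message selects [x1] in it.  If the index of
    [u2] were uniform and the state were drawn from P(s | u1, u2), the decoder
    would face a memoryless channel V(y | u1, u2, x1); thresholds on the three
    likelihood ratios of V with respect to P(y | u1, u2), P(y | u1) and P(y),
    followed by a union bound, give the three rate constraints.  A wrong [u2]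
    with the right messages is not an error.

    The true state law differs from the idealised one by the gap between Q and
    the average of P(s | u1, u2) over the list of [u2]; a second moment
    computation (soft covering) shows that this gap is small as soon as the
    list has rate above I(U2; S | U1).

    The one-shot bound is applied to tensor powers, where the exceptional
    probabilities decay geometrically by Chernoff's bound. *)

Set Implicit Arguments.
Unset Strict Implicit.
Unset Printing Implicit Defensive.
Import Order.TTheory GRing.Theory Num.Theory.
Local Open Scope ring_scope.

(** * Expectations on finite types *)

Section Expectation.
Variable K : realFieldType.

Definition prob (T : finType) (p : T -> K) : Prop :=
  (forall x, 0 <= p x) /\ \sum_x p x = 1.

Definition E (T : finType) (p h : T -> K) : K := \sum_x p x * h x.

Definition prodm (I A : finType) (q : I -> A -> K) (f : {ffun I -> A}) : K :=
  \prod_i q i (f i).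

Section Basic.
Variables (T : finType) (p : T -> K).

Lemma eq_E h h' : h =1 h' -> E p h = E p h'.
Proof. by move=> eqh; apply: eq_bigr => x _; rewrite eqh. Qed.

Lemma ler_E h h' :
  (forall x, 0 <= p x) -> (forall x, h x <= h' x) -> E p h <= E p h'.
Proof. by move=> p0 le_h; apply: ler_sum => x _; apply: ler_wpM2l. Qed.

Lemma E_ge0 h : (forall x, 0 <= p x) -> (forall x, 0 <= h x) -> 0 <= E p h.
Proof. by move=> p0 h0; apply: sumr_ge0 => x _; apply: mulr_ge0. Qed.

Lemma E_gt0 h x :
  (forall x, 0 <= p x) -> (forall x, 0 <= h x) -> 0 < p x -> 0 < h x ->
  0 < E p h.
Proof.
move=> p0 h0 px hx; rewrite /E (bigD1 x) //= ltr_pwDl ?mulr_gt0 //.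
by apply: sumr_ge0 => y _; apply: mulr_ge0.
Qed.

Lemma eq_E_supp h h' : (forall x, 0 <= p x) ->
  (forall x, 0 < p x -> h x = h' x) -> E p h = E p h'.
Proof.
move=> p0 eqh; apply: eq_bigr => x _.
have [->|px] := eqVneq (p x) 0; first by rewrite !mul0r.
by rewrite eqh // lt0r px p0.
Qed.

Lemma E_cst c : prob p -> E p (fun=> c) = c.
Proof. by case=> _ p1; rewrite /E -mulr_suml p1 mul1r. Qed.

Lemma E_le_cst h c : prob p -> (forall x, h x <= c) -> E p h <= c.
Proof. by move=> pp le_h; rewrite -(E_cst c pp); apply: ler_E => //; case: pp. Qed.

Lemma ED h h' : E p (fun x => h x + h' x) = E p h + E p h'.
Proof. by rewrite -big_split; apply: eq_bigr => x _; rewrite mulrDr. Qed.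

Lemma EB h h' : E p (fun x => h x - h' x) = E p h - E p h'.
Proof. by rewrite -sumrB; apply: eq_bigr => x _; rewrite mulrBr. Qed.

Lemma EZ c h : E p (fun x => c * h x) = c * E p h.
Proof. by rewrite mulr_sumr; apply: eq_bigr => x _; rewrite mulrCA. Qed.

Lemma EZr c h : E p (fun x => h x * c) = E p h * c.
Proof. by rewrite mulr_suml; apply: eq_bigr => x _; rewrite mulrA. Qed.

Lemma E_sum (I : Type) (r : seq I) (P : pred I) (h : I -> T -> K) :
  E p (fun x => \sum_(i <- r | P i) h i x) = \sum_(i <- r | P i) E p (h i).
Proof. by rewrite /E exchange_big; apply: eq_bigr => x _; rewrite mulr_sumr. Qed.

Lemma E_exchange (A : finType) (q : A -> K) (h : T -> A -> K) :
  E p (fun x => E q (h x)) = E q (fun y => E p (h^~ y)).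
Proof.
rewrite {1}/E; under eq_bigr do rewrite mulr_sumr.
rewrite exchange_big; apply: eq_bigr => y _; rewrite mulr_sumr.
by apply: eq_bigr => x _; rewrite mulrCA.
Qed.

Lemma E_pick x0 h : E p (fun x => (x == x0)%:R * h x) = p x0 * h x0.
Proof.
rewrite /E (bigD1 x0) //= eqxx mul1r big1 ?addr0 // => x /negPf ->.
by rewrite mul0r mulr0.
Qed.

Lemma E_pick1 x0 : E p (fun x => (x == x0)%:R) = p x0.
Proof.
by rewrite -[RHS]mulr1 -(E_pick _ (fun=> 1)); apply: eq_E => x; rewrite mulr1.
Qed.

(** The probabilistic method: were [h] above [c] everywhere, the weighted sum of the excess could
    vanish only if [p] were identically zero. It selects the codebook and, with a constant [h],
    produces a point of an alphabet. *)
Lemma E_exists_le h c : prob p -> E p h <= c -> exists x, h x <= c.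
Proof.
move=> pp le_hc; case: (boolP [exists x, h x <= c]) => [/existsP //|].
rewrite negb_exists => /forallP h_gt.
have [p0 p1] := pp.
have /lt_le_trans/(_ le_hc) : c < E p h; last by rewrite ltxx.
rewrite -subr_gt0 -{1}(E_cst c pp) -EB lt_def; apply/andP; split; last first.
  by apply: E_ge0 => // x; rewrite subr_ge0 ltW // ltNge.
apply: contra_eq_neq p1 => /eqP; rewrite psumr_eq0; last first.
  by move=> x _; rewrite mulr_ge0 // subr_ge0 ltW // ltNge.
move=> /allP eq0; rewrite big1 ?(eq_sym 0) ?oner_neq0 // => x _.
have /eqP := eq0 x (mem_index_enum x) => /eqP/=; rewrite mulf_eq0 subr_eq0.
by case/orP => [/eqP //|/eqP hx]; have := h_gt x; rewrite hx lexx.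
Qed.

End Basic.

Lemma prob_channel_mix (T A : finType) (p : T -> K) (w : T -> A -> K) :
  prob p -> (forall x, prob (w x)) -> prob (fun y => E p (w^~ y)).
Proof.
move=> pp pw; split=> [y|]; first by apply: E_ge0 => [|x]; [case: pp|case: (pw x)].
rewrite -E_sum -[RHS](E_cst 1 pp); apply: eq_E => x; by case: (pw x).
Qed.

Lemma E_mix (T A : finType) (p : T -> K) (w : T -> A -> K) h :
  E (fun y => E p (w^~ y)) h = E p (fun x => E (w x) h).
Proof.
rewrite {1}/E; under eq_bigr do rewrite mulr_suml.
rewrite exchange_big; apply: eq_bigr => x _; rewrite mulr_sumr.
by apply: eq_bigr => y _; rewrite mulrA.
Qed.

Definition pairm (T A : finType) (p : T -> K) (w : T -> A -> K) (xy : T * A) : K :=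
  p xy.1 * w xy.1 xy.2.

Lemma E_pairm (T A : finType) (p : T -> K) (w : T -> A -> K) h :
  E (pairm p w) h = E p (fun x => E (w x) (fun y => h (x, y))).
Proof.
rewrite /E; under [RHS]eq_bigr do rewrite mulr_sumr.
by rewrite pair_bigA; apply: eq_bigr => -[x y] _; rewrite mulrA.
Qed.

Lemma prob_pairm (T A : finType) (p : T -> K) (w : T -> A -> K) :
  prob p -> (forall x, prob (w x)) -> prob (pairm p w).
Proof.
move=> pp pw; split=> [[x y]|].
  by apply: mulr_ge0; [case: pp|case: (pw x)].
transitivity (E (pairm p w) (fun=> 1)).
  by apply: eq_bigr => xy _; rewrite mulr1.
by rewrite E_pairm -[RHS](E_cst 1 pp); apply: eq_E => x; apply: E_cst.
Qed.

(** * Laws of independent coordinates *)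

Section Product.
Variables (I A : finType).

Lemma E_prodm (q : I -> A -> K) (h : I -> A -> K) :
  E (prodm q) (fun f => \prod_i h i (f i)) = \prod_i E (q i) (h i).
Proof.
by rewrite bigA_distr_bigA; apply: eq_bigr => f _; rewrite big_split.
Qed.

Lemma prob_prodm (q : I -> A -> K) :
  (forall i, prob (q i)) -> prob (prodm q).
Proof.
move=> pq; split=> [f|]; first by apply: prodr_ge0 => i _; case: (pq i).
by rewrite -(bigA_distr_bigA q) big1 // => i _; case: (pq i).
Qed.

Lemma E_prodm1 (q : I -> A -> K) i (h : A -> K) :
  (forall i, prob (q i)) -> E (prodm q) (fun f => h (f i)) = E (q i) h.
Proof.
move=> pq; pose h' j := if j == i then h else fun=> 1.
transitivity (E (prodm q) (fun f => \prod_j h' j (f j))).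
  apply: eq_E => f; rewrite (bigD1 i) //= big1 ?mulr1 /h' ?eqxx // => j.
  by move=> /negPf ->.
rewrite E_prodm (bigD1 i) //= big1 ?mulr1 /h' ?eqxx // => j /negPf ->.
exact: E_cst.
Qed.

Lemma E_prodm2 (q : I -> A -> K) i j (h : A -> A -> K) :
  (forall i, prob (q i)) -> i != j ->
  E (prodm q) (fun f => h (f i) (f j)) = E (q i) (fun x => E (q j) (h x)).
Proof.
move=> pq neq_ij; have neq_ji : (j == i) = false by rewrite eq_sym (negPf neq_ij).
(* The product over [l] of [d a b l (f l)] is the indicator of [f i = a] and [f j = b], a form to
   which [E_prodm] applies. *)
pose d a b l (x : A) : K :=
  if l == i then (x == a)%:R else if l == j then (x == b)%:R else 1.
have dE (F : I -> K) :
    (forall l, l != i -> l != j -> F l = 1) ->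
    \prod_l F l = F i * F j.
  move=> F1; rewrite (bigD1 i) //= (bigD1 j) 1?eq_sym //= big1 ?mulr1 //.
  by move=> l /andP[li lj]; apply: F1.
transitivity (\sum_a \sum_b h a b * (q i a * q j b)); last first.
  apply: eq_bigr => a _; rewrite mulr_sumr; apply: eq_bigr => b _; ring.
transitivity (\sum_a \sum_b h a b * E (prodm q) (fun f => \prod_l d a b l (f l))).
  under [RHS]eq_bigr do under eq_bigr do rewrite -EZ.
  under [RHS]eq_bigr do rewrite -E_sum.
  rewrite -E_sum; apply: eq_E => f.
  rewrite (bigD1 (f i)) //= (bigD1 (f j)) //= dE; last first.
    by move=> l /negPf li /negPf lj; rewrite /d li lj.
  rewrite /d !eqxx neq_ji !mulr1 big1 ?big1 ?addr0 //.
    move=> a ai; rewrite big1 // => b _; rewrite (bigD1 i) //= eqxx eq_sym (negPf ai).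
    by rewrite mul0r mulr0.
  move=> b bj; rewrite (bigD1 j) //= neq_ji eqxx eq_sym (negPf bj).
  by rewrite mul0r mulr0.
apply: eq_bigr => a _; apply: eq_bigr => b _; congr (_ * _).
rewrite E_prodm dE; last first.
  by move=> l /negPf li /negPf lj; rewrite /d li lj E_cst.
rewrite /d !eqxx neq_ji.
by rewrite !E_pick1.
Qed.

End Product.
End Expectation.

(** * Soft covering *)

Section Covering.
Variables (K : realFieldType) (U S J : finType).
Variables (a : U -> K) (k : U -> S -> K) (h eps : K).
Hypotheses (pa : prob a) (pk : forall u, prob (k u)).
Hypotheses (h0 : 0 <= h) (eps0 : 0 < eps) (J0 : (0 < #|J|)%N).

(** Expanding the square of the centred sample mean, independence kills the off-diagonal terms; the
    diagonal gives the variance of [t], which is at most its second moment. *)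
Lemma sample_variance_le (t : U -> K) :
  E (prodm (fun _ : J => a))
    (fun f => (E a t - #|J|%:R^-1 * \sum_j t (f j)) ^+ 2)
  <= #|J|%:R^-1 * E a (fun u => t u ^+ 2).
Proof.
set m := E a t; set N : K := #|J|%:R.
have N0 : N != 0 by rewrite pnatr_eq0 -lt0n.
have Ngt0 : 0 < N by rewrite ltr0n.
have mE : E a (fun u => m - t u) = 0 by rewrite EB E_cst // subrr.
have sqE : E a (fun u => (m - t u) * (m - t u)) <= E a (fun u => t u ^+ 2).
  have -> : E a (fun u => (m - t u) * (m - t u))
      = E a (fun u => t u ^+ 2) - m ^+ 2.
    transitivity (E a (fun u => t u ^+ 2 - (2 * m * t u - m ^+ 2))).
      by apply: eq_E => u; ring.
    by rewrite !EB EZ E_cst // -/m; ring.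
  by rewrite lerBlDr lerDl sqr_ge0.
pose g (f : {ffun J -> U}) j := m - t (f j).
have -> : E (prodm (fun _ : J => a)) (fun f => (m - N^-1 * \sum_j t (f j)) ^+ 2)
    = N^-1 ^+ 2 * \sum_i \sum_j E (prodm (fun _ : J => a)) (fun f => g f i * g f j).
  under [in RHS]eq_bigr do rewrite -E_sum.
  rewrite -E_sum -EZ; apply: eq_E => f.
  under [in RHS]eq_bigr do rewrite -mulr_sumr.
  rewrite -mulr_suml -expr2 -exprMn; congr (_ ^+ 2).
  rewrite /g sumrB sumr_const -mulr_natl mulrBr mulrA mulVf // mul1r //.
have -> : \sum_i \sum_j E (prodm (fun _ : J => a)) (fun f => g f i * g f j)
    = N * E a (fun u => (m - t u) * (m - t u)).
  rewrite mulr_natl -sumr_const; apply: eq_bigr => i _.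
  rewrite (bigD1 i) //= big1 ?addr0 => [|j ji].
    by rewrite /g (E_prodm1 i (fun u => (m - t u) * (m - t u))).
  rewrite /g (E_prodm2 (fun u v => (m - t u) * (m - t v))) // 1?eq_sym //.
  by under eq_E do rewrite EZ mE mulr0; rewrite E_cst.
rewrite mulrA expr2 -(mulrA _ _ N) mulVf // mulr1.
by rewrite ler_pM2l ?invr_gt0.
Qed.

Definition mix_out s := E a (k^~ s).

(** Discarding the points where [k] exceeds [h] times its mean keeps the second moment under
    control. *)
Definition trunc u s := k u s * (k u s <= h * mix_out s)%R%:R.

(** Mass lost by truncation, a slack, and a squared deviation. The deviation is squared so that its
    mean over random lists is a variance. *)
Definition covering_gap (f : {ffun J -> U}) s :=
  (mix_out s - E a (trunc^~ s)) + eps * mix_out s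
  + (E a (trunc^~ s) - #|J|%:R^-1 * \sum_j trunc (f j) s) ^+ 2
    / (4 * eps * mix_out s).

Let a0 u : 0 <= a u. Proof. by case: pa. Qed.
Let k0 u s : 0 <= k u s. Proof. by case: (pk u). Qed.

Let Q0 s : 0 <= mix_out s. Proof. by apply: E_ge0 => u. Qed.

Let trunc_ge0 u s : 0 <= trunc u s. Proof. exact: mulr_ge0. Qed.

Let trunc_le u s : trunc u s <= k u s.
Proof. by rewrite /trunc; case: (k u s <= _); rewrite /= ?mulr1 ?mulr0. Qed.

Let Etrunc_le s : E a (trunc^~ s) <= mix_out s.
Proof. exact: ler_E. Qed.

Lemma covering_gap_ge0 f s : 0 <= covering_gap f s.
Proof.
have e0 : 0 <= eps := ltW eps0.
rewrite addr_ge0 ?divr_ge0 ?sqr_ge0 ?mulr_ge0 //.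
by rewrite addr_ge0 ?subr_ge0 ?mulr_ge0.
Qed.

(* The empirical output falls short of the target by at most its mean
   truncation loss plus a deviation, linearised by AM-GM: [x <= e + x^2/(4e)]
   with [e = eps * Q s]; at [Q s = 0] the inverse is [0] but the deviation is
   nonpositive. *)
Lemma mix_out_le (f : {ffun J -> U}) s :
  mix_out s <= #|J|%:R^-1 * \sum_j k (f j) s + covering_gap f s.
Proof.
rewrite /covering_gap.
set P := #|J|%:R^-1 * \sum_j k (f j) s.
set P' := #|J|%:R^-1 * \sum_j trunc (f j) s.
have le_tr : P' <= P by rewrite ler_wpM2l ?invr_ge0 // ler_sum.
have tr0 : 0 <= P' by rewrite mulr_ge0 ?invr_ge0 // sumr_ge0.
have := Etrunc_le s; set q := E a _; set Q := mix_out s => leQ.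
suff : q - P' <= eps * Q + (q - P') ^+ 2 / (4 * eps * Q).
  by set z := _ / _; lra.
have [Q_eq0|Q_neq0] := eqVneq Q 0.
  by rewrite Q_eq0 !mulr0 invr0 mulr0; rewrite Q_eq0 in leQ; lra.
have Q_gt0 : 0 < Q by rewrite lt_def Q_neq0 Q0.
have eQ : 0 < 4 * (eps * Q) by rewrite !mulr_gt0 // ltr0n.
rewrite -mulrA -subr_ge0.
have -> : eps * Q + (q - P') ^+ 2 / (4 * (eps * Q)) - (q - P')
    = (2 * (eps * Q) - (q - P')) ^+ 2 / (4 * (eps * Q)).
  by field; rewrite Q_neq0 gt_eqF.
by rewrite divr_ge0 ?sqr_ge0 // ltW.
Qed.

(** The truncated mass sums to the probability that [k] exceeds [h * mix_out]. For the variance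
    term, [trunc] is at most both [h * mix_out] and [k], so its second moment is at most
    [h * mix_out s ^+ 2]; dividing by [4 * eps * mix_out s] leaves a multiple of [mix_out s], which
    sums to one. *)
Lemma mean_covering_gap :
  E (prodm (fun _ : J => a)) (fun f => \sum_s covering_gap f s)
  <= E a (fun u => E (k u) (fun s => (h * mix_out s < k u s)%R%:R))
     + eps + h / (4 * eps * #|J|%:R).
Proof.
have pP : prob (prodm (fun _ : J => a)) by apply: prob_prodm.
have sumQ : \sum_s mix_out s = 1.
  by have [_] := prob_channel_mix pa pk.
rewrite E_sum.
have -> : E a (fun u => E (k u) (fun s => (h * mix_out s < k u s)%R%:R))
    = \sum_s (mix_out s - E a (trunc^~ s)).
  under [RHS]eq_bigr do rewrite -EB.
  rewrite -E_sum; apply: eq_E => u; apply: eq_bigr => s _.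
  by rewrite /trunc ltNge; case: (_ <= _); rewrite /= ?mulr0 ?mulr1 ?subrr ?subr0.
(* The constants are spread over [s] with weights [mix_out s], so that the two sides can be compared
   term by term. *)
have toQ x : x = \sum_s x * mix_out s by rewrite -mulr_sumr sumQ mulr1.
rewrite [X in _ <= _ + X + _]toQ [X in _ <= _ + X]toQ -!big_split /=.
apply: ler_sum => s _; rewrite !ED !E_cst // lerD2l EZr.
apply: (@le_trans _ _ (#|J|%:R^-1 * E a (fun u => trunc u s ^+ 2) / (4 * eps * mix_out s))).
  rewrite ler_wpM2r ?sample_variance_le //.
  by rewrite invr_ge0 !mulr_ge0 // ltW.
have -> : h / (4 * eps * #|J|%:R) * mix_out s = #|J|%:R^-1 * (h * mix_out s ^+ 2) / (4 * eps * mix_out s).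
  have [->|Q_neq0] := eqVneq (mix_out s) 0; first by rewrite !mulr0 invr0 !mulr0.
  by field; rewrite Q_neq0 gt_eqF //= pnatr_eq0 -lt0n.
apply: ler_wpM2r; first by rewrite invr_ge0 !mulr_ge0 // ltW.
apply: ler_wpM2l; first by rewrite invr_ge0.
rewrite [mix_out s ^+ 2]expr2 mulrA -[X in _ <= _ * X]/(E a (k^~ s)) -EZ.
apply: ler_E => // u; rewrite /trunc.
case: (boolP (k u s <= _)) => [le_k|_] /=; last by rewrite mulr0 expr2 mul0r !mulr_ge0.
by rewrite mulr1 expr2 ler_wpM2r.
Qed.

End Covering.

(** * One-shot coding *)

Section OneShot.
Variables (K : realFieldType) (U1 U2 X1 X2 S Y : finType).
Variables (p : U1 -> K) (a : U1 -> U2 -> K) (b : U1 -> X1 -> K)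
  (k : U1 -> U2 -> S -> K) (c : U1 -> U2 -> S -> X2 -> K)
  (W : X1 -> X2 -> S -> Y -> K).

Definition chanV u1 u2 x1 y : K :=
  E (k u1 u2) (fun s => E (c u1 u2 s) (fun x2 => W x1 x2 s y)).

Definition out_u1u2 u1 u2 y : K := E (b u1) (fun x1 => chanV u1 u2 x1 y).

Definition out_u1 u1 y : K := E (a u1) (fun u2 => out_u1u2 u1 u2 y).

Definition out y : K := E p (fun u1 => out_u1 u1 y).

(** The idealised law: the state is drawn after [u2], from [k], and is independent of [x1] given
    [u1] and [u2]. *)
Definition jointE (h : U1 -> U2 -> X1 -> S -> X2 -> Y -> K) : K :=
  E p (fun u1 => E (a u1) (fun u2 => E (b u1) (fun x1 =>
  E (k u1 u2) (fun s => E (c u1 u2 s) (fun x2 =>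
  E (W x1 x2 s) (h u1 u2 x1 s x2)))))).

Hypotheses (pp : prob p) (pa : forall u1, prob (a u1))
  (pb : forall u1, prob (b u1)) (pk : forall u1 u2, prob (k u1 u2))
  (pc : forall u1 u2 s, prob (c u1 u2 s))
  (pW : forall x1 x2 s, prob (W x1 x2 s)).

Lemma ler_jointE h h' :
  (forall u1 u2 x1 s x2 y, h u1 u2 x1 s x2 y <= h' u1 u2 x1 s x2 y) ->
  jointE h <= jointE h'.
Proof.
move=> le_h.
apply: ler_E => [|u1]; first by case: pp.
apply: ler_E => [|u2]; first by case: (pa u1).
apply: ler_E => [|x1]; first by case: (pb u1).
apply: ler_E => [|s]; first by case: (pk u1 u2).
apply: ler_E => [|x2]; first by case: (pc u1 u2 s).
by apply: ler_E => [|y]; first by case: (pW x1 x2 s).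
Qed.

Lemma jointED h h' :
  jointE (fun u1 u2 x1 s x2 y => h u1 u2 x1 s x2 y + h' u1 u2 x1 s x2 y)
  = jointE h + jointE h'.
Proof.
rewrite /jointE -ED; apply: eq_E => u1; rewrite -ED; apply: eq_E => u2.
rewrite -ED; apply: eq_E => x1; rewrite -ED; apply: eq_E => s.
by rewrite -ED; apply: eq_E => x2; rewrite -ED.
Qed.

Lemma E_chanV u1 u2 x1 h :
  E (chanV u1 u2 x1) h
  = E (k u1 u2) (fun s => E (c u1 u2 s) (fun x2 => E (W x1 x2 s) h)).
Proof. by rewrite E_mix; apply: eq_E => s; rewrite E_mix. Qed.

Lemma prob_chanV u1 u2 x1 : prob (chanV u1 u2 x1).
Proof. by apply: prob_channel_mix => // s; apply: prob_channel_mix. Qed.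

(** * Random codebook, threshold decoder and union bound *)

Section Coding.
Variables (Q : S -> K) (Mc M1 J : finType) (g1 g2 g3 h eps : K).
Hypothesis mixQ : forall u1 s, E (a u1) (fun u2 => k u1 u2 s) = Q s.
Hypotheses (g1_gt0 : 0 < g1) (g2_gt0 : 0 < g2) (g3_gt0 : 0 < g3).
Hypotheses (h_ge0 : 0 <= h) (eps_gt0 : 0 < eps).
Hypotheses (Mc_gt0 : (0 < #|Mc|)%N) (M1_gt0 : (0 < #|M1|)%N).
Hypothesis J_gt0 : (0 < #|J|)%N.

Definition good u1 u2 x1 y : bool :=
  [&& g1 * out_u1u2 u1 u2 y < chanV u1 u2 x1 y,
      g2 * out_u1 u1 y < chanV u1 u2 x1 y
    & g3 * out y < chanV u1 u2 x1 y].

(** Change of measure: on good outputs [q] is below [g^-1] times [chanV], whose total mass is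
    one. *)
Let E_out_good (q : Y -> K) g u1 u2 x1 :
  (forall y, good u1 u2 x1 y -> g * q y < chanV u1 u2 x1 y) -> 0 < g ->
  E q (fun y => (good u1 u2 x1 y)%:R) <= g^-1.
Proof.
move=> le_q g_gt0; have [V0 V1] := prob_chanV u1 u2 x1.
have -> : g^-1 = \sum_y g^-1 * chanV u1 u2 x1 y by rewrite -mulr_sumr V1 mulr1.
apply: ler_sum => y _.
rewrite mulrC; case: (boolP (good _ _ _ _)) => [/le_q/ltW le_V|_] /=.
  by rewrite mul1r ler_pdivlMl.
by rewrite mul0r mulr_ge0 // invr_ge0 ltW.
Qed.

Let block := (U1 * {ffun J -> U2} * {ffun M1 -> X1})%type.

Let block_law : block -> K :=
  pairm (pairm p (fun u => prodm (fun _ : J => a u)))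
        (fun uf => prodm (fun _ : M1 => b uf.1)).

Let book := {ffun Mc -> block}.

Let book_law : book -> K := prodm (fun _ : Mc => block_law).

Let prob_block : prob block_law.
Proof.
apply: prob_pairm => [|uf]; last exact: prob_prodm.
by apply: prob_pairm => // u; apply: prob_prodm.
Qed.

Let prob_book : prob book_law. Proof. exact: prob_prodm. Qed.

Let E_block F : E block_law F =
  E p (fun u => E (prodm (fun _ : J => a u)) (fun f =>
    E (prodm (fun _ : M1 => b u)) (fun g => F (u, f, g)))).
Proof. by rewrite E_pairm E_pairm. Qed.

Let E_block1 j w (F : U1 -> U2 -> X1 -> K) :
  E block_law (fun B => F B.1.1 (B.1.2 j) (B.2 w)) =
  E p (fun u => E (a u) (fun u2 => E (b u) (F u u2))).
Proof.
rewrite E_block; apply: eq_E => u /=.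
rewrite -(E_prodm1 j (fun u2 => E (b u) (F u u2)) (fun=> pa u)).
apply: eq_E => f.
by rewrite -(E_prodm1 w (F u (f j)) (fun=> pb u)).
Qed.

Let goodC (C : book) (m : Mc * M1) j y :=
  good (C m.1).1.1 ((C m.1).1.2 j) ((C m.1).2 m.2) y.

Let VC (C : book) (m : Mc * M1) j :=
  chanV (C m.1).1.1 ((C m.1).1.2 j) ((C m.1).2 m.2).

(** Averaging over the transmitted codewords while the competing ones stay fixed turns [chanV] into
    a coarser output law: [out] for another cloud, [out_u1] for the same cloud with both indices
    different, [out_u1u2] when [u2] is shared. [E_out_good] then applies with the matching
    threshold. *)
Let false_hit m m' j j' : m' != m ->
  E book_law (fun C => E (VC C m j) (fun y => (goodC C m' j' y)%:R))
  <= g3^-1 + (m'.1 == m.1)%:R * (g2^-1 + (j' == j)%:R * g1^-1).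
Proof.
case: m m' => [w v] [w' v'] neq_m; rewrite /VC /goodC /=.
have [eqw|neq_w] := eqVneq w' w; last first.
  rewrite mul0r addr0.
  rewrite (E_prodm2 (i := w) (j := w') (fun B B' : block =>
    E (chanV B.1.1 (B.1.2 j) (B.2 v))
      (fun y => (good B'.1.1 (B'.1.2 j') (B'.2 v') y)%:R))) //; last first.
    by rewrite eq_sym.
  (* The competing cloud [B'] is fixed; the mean over the transmitted cloud produces [out]. *)
  rewrite E_exchange; apply: E_le_cst => // B'.
  rewrite (E_block1 j v (fun u u2 x1 => E (chanV u u2 x1)
    (fun y => (good B'.1.1 (B'.1.2 j') (B'.2 v') y)%:R))).
  have := @E_out_good out g3 B'.1.1 (B'.1.2 j') (B'.2 v').
  rewrite E_mix; under eq_E do rewrite E_mix; under eq_E do under eq_E do rewrite E_mix.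
  by apply=> // y /and3P[].
subst w'; have {}neq_v : v != v'.
  by apply: contraNneq neq_m => ->.
rewrite mul1r (E_prodm1 w (fun B : block => E (chanV B.1.1 (B.1.2 j) (B.2 v))
    (fun y => (good B.1.1 (B.1.2 j') (B.2 v') y)%:R))) // E_block /=.
apply: (@le_trans _ _ (g2^-1 + (j' == j)%:R * g1^-1)); last first.
  by rewrite lerDr invr_ge0 ltW.
apply: E_le_cst => // u.
(* Within one cloud, the entries [x1] at [v] and [v'] are independent given [u]. *)
under eq_E do rewrite (E_prodm2 (fun x x' => E (chanV u _ x)
    (fun y => (good u _ x' y)%:R)) (fun=> pb u) neq_v) E_exchange.
have [eqj|neq_j] := eqVneq j' j.
  subst j'; rewrite mul1r; apply: (@le_trans _ _ g1^-1); last first.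
    by rewrite lerDr invr_ge0 ltW.
  apply: E_le_cst => [|f]; first exact: prob_prodm.
  apply: E_le_cst => // x'; rewrite -E_mix.
  by apply: E_out_good => // y /and3P[].
rewrite mul0r addr0.
rewrite (E_prodm2 (i := j) (j := j') (fun u2 u2' => E (b u) (fun x' => E (b u) (fun x =>
  E (chanV u u2 x) (fun y => (good u u2' x' y)%:R))))) //; last by rewrite eq_sym.
rewrite E_exchange; apply: E_le_cst => // u2'.
rewrite E_exchange; apply: E_le_cst => // x'.
have := @E_out_good (out_u1 u) g2 u u2' x'.
rewrite E_mix; under eq_E do rewrite E_mix.
by apply=> // y /and3P[].
Qed.

Let hit C y m := [exists j, goodC C m j y].

Let m0 : Mc * M1 := (enum_val (Ordinal Mc_gt0), enum_val (Ordinal M1_gt0)).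

Let decC C y : Mc * M1 := odflt m0 [pick m | hit C y m].

(** The decoder can return a wrong message only if the true triple fails a threshold or some other
    message is hit through some list index; the sum over these indices is the union bound. *)
Let decC_err C y m j : (decC C y != m)%:R
  <= (~~ goodC C m j y)%:R + \sum_(m' | m' != m) \sum_j' (goodC C m' j' y)%:R :> K.
Proof.
have ge0 (P : pred (Mc * M1)) : 0 <= \sum_(m' | P m') \sum_j' (goodC C m' j' y)%:R :> K.
  by apply: sumr_ge0 => m' _; apply: sumr_ge0.
have [/= goodm|_] := boolP (goodC C m j y); last first.
  by apply: (@le_trans _ _ 1); rewrite ?lerDl ?ge0 //; case: (_ != _).
rewrite add0r; have [_|neq_m] := eqVneq (decC C y) m; first exact: ge0.
have [j' goodj'] : exists j', goodC C (decC C y) j' y.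
  apply/existsP; rewrite /decC; case: pickP => [m' //|/(_ m)].
  by have -> : hit C y m by apply/existsP; exists j.
rewrite (bigD1 (decC C y)) //= (bigD1 j') //= goodj' -addrA lerDl.
by rewrite addr_ge0 ?ge0 //; apply: sumr_ge0.
Qed.

(** Every competing pair of message and list index contributes [g3^-1]; the [#|M1|] messages of the
    same cloud add [g2^-1] for each list index and [g1^-1] for the shared one. *)
Let decoding_error m j :
  E book_law (fun C => E (VC C m j) (fun y => (decC C y != m)%:R))
  <= jointE (fun u1 u2 x1 s x2 y => (~~ good u1 u2 x1 y)%:R)
     + (#|Mc| * #|M1| * #|J|)%:R / g3 + (#|M1| * #|J|)%:R / g2 + #|M1|%:R / g1.
Proof.
have [P0 _] := prob_book.
apply: (@le_trans _ _ (E book_law (fun C => E (VC C m j) (fun y =>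
  (~~ goodC C m j y)%:R + \sum_(m' | m' != m) \sum_j' (goodC C m' j' y)%:R)))).
  apply: ler_E => [C|C]; first exact: P0.
  apply: ler_E => [y|y]; last exact: decC_err.
  by have [V0 _] := prob_chanV (C m.1).1.1 ((C m.1).1.2 j) ((C m.1).2 m.2); apply: V0.
under eq_E do rewrite ED; rewrite ED -!addrA; apply: lerD.
  rewrite /VC /goodC (E_prodm1 m.1 (fun B : block =>
    E (chanV B.1.1 (B.1.2 j) (B.2 m.2))
      (fun y => (~~ good B.1.1 (B.1.2 j) (B.2 m.2) y)%:R))) //.
  rewrite (E_block1 j m.2 (fun u u2 x1 => E (chanV u u2 x1)
    (fun y => (~~ good u u2 x1 y)%:R))).
  rewrite le_eqVlt; apply/orP; left; apply/eqP; apply: eq_E => u; apply: eq_E => u2; apply: eq_E => x1.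
  by rewrite E_chanV.
under eq_E do rewrite E_sum; rewrite E_sum.
under eq_bigr do under eq_E do rewrite E_sum.
under eq_bigr do rewrite E_sum.
(* Including the true message only adds nonnegative terms and makes the counts exact. *)
apply: (@le_trans _ _ (\sum_(m' : Mc * M1) \sum_(j' : J)
  (g3^-1 + (m'.1 == m.1)%:R * (g2^-1 + (j' == j)%:R * g1^-1)))).
  rewrite [X in _ <= X](bigID (fun m' => m' != m)) /=.
  rewrite -[X in X <= _]addr0; apply: lerD.
    by apply: ler_sum => m' neq_m; apply: ler_sum => j' _; apply: false_hit.
  apply: sumr_ge0 => m' _; apply: sumr_ge0 => j' _.
  by rewrite !(addr_ge0, mulr_ge0) ?invr_ge0 // ltW.
have sumJ : \sum_(j' : J) (g2^-1 + (j' == j)%:R * g1^-1) = #|J|%:R / g2 + g1^-1.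
  have sum1 : \sum_(j' : J) (j' == j)%:R = 1 :> K.
    by rewrite (bigD1 j) //= eqxx big1 ?addr0 // => i /negPf ->.
  by rewrite big_split /= sumr_const -mulr_suml sum1 mul1r mulr_natl.
under eq_bigr do rewrite big_split /= sumr_const -mulr_sumr sumJ.
rewrite big_split /= sumr_const card_prod -mulr_suml.
have -> : \sum_(m' : Mc * M1) (m'.1 == m.1)%:R = #|M1|%:R :> K.
  rewrite -(pair_bigA _ (fun w _ => (w == m.1)%:R)) /=.
  under eq_bigr do rewrite sumr_const.
  rewrite (bigD1 m.1) //= eqxx big1 ?addr0 // => i /negPf ->.
  by rewrite mul0rn.
rewrite -mulrnA mulnC -[X in X + _ <= _]mulr_natl.
by rewrite !natrM mulrDr !mulrA.
Qed.

(** The informed encoder sees [w] and the state but not [v], so its cost adds up the errors over all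
    [v]; it is not normalised. *)
Let costC (C : book) w s x2 : K :=
  \sum_v E (W ((C w).2 v) x2 s) (fun y => (decC C y != (w, v))%:R).

Let costC_ge0 C w s x2 : 0 <= costC C w s x2.
Proof. by apply: sumr_ge0 => v _; apply: E_ge0 => // y; case: (pW ((C w).2 v) x2 s). Qed.

Let costC_le C w s x2 : costC C w s x2 <= #|M1|%:R.
Proof.
apply: (@le_trans _ _ (\sum_(v : M1) 1)); last by rewrite sumr_const.
by apply: ler_sum => v _; apply: E_le_cst => // y; rewrite lern1 leq_b1.
Qed.

Let gapC (C : book) w s := covering_gap (a (C w).1.1) (k (C w).1.1) h eps (C w).1.2 s.

(* The informed encoder needs no explicit binning rule: any distribution on
   the inputs is dominated by the input of least cost. *)
Let best_enc2 C (x0 : X2) : exists e2 : S -> Mc -> X2, forall w,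
  E Q (fun s => costC C w s (e2 s w))
  <= #|J|%:R^-1 * \sum_j \sum_v E (VC C (w, v) j) (fun y => (decC C y != (w, v))%:R)
     + #|M1|%:R * \sum_s gapC C w s.
Proof.
exists (fun s w => [arg min_(x < x0) costC C w s x]%O) => w.
set u := (C w).1.1; set f := (C w).1.2.
pose best s := costC C w s [arg min_(x < x0) costC C w s x]%O.
have best_le s x : best s <= costC C w s x.
  by rewrite /best; case: arg_minP => // i _ /(_ x); apply.
(* Soft covering replaces [Q s] by the average of [k] over the list plus the gap, which is charged
   below at the maximal cost [#|M1|]. *)
apply: (@le_trans _ _ (\sum_s (#|J|%:R^-1 * \sum_j k u (f j) s + gapC C w s) * best s)).
  apply: ler_sum => s _; rewrite -/(best s); apply: ler_wpM2r; first exact: costC_ge0.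
  by rewrite -(mixQ u); apply: mix_out_le.
under eq_bigr do rewrite mulrDl; rewrite big_split /=; apply: lerD; last first.
  rewrite mulr_sumr.
  apply: ler_sum => s _; rewrite mulrC; apply: ler_wpM2r; last exact: costC_le.
  exact: covering_gap_ge0.
under eq_bigr do rewrite -mulrA; rewrite -mulr_sumr.
apply: ler_wpM2l; first by rewrite invr_ge0.
under [X in X <= _]eq_bigr do rewrite mulr_suml; rewrite exchange_big /=.
apply: ler_sum => j _.
have -> : \sum_v E (VC C (w, v) j) (fun y => (decC C y != (w, v))%:R) =
    E (k u (f j)) (fun s => E (c u (f j) s) (costC C w s)).
  under eq_bigr do rewrite /VC /= E_chanV.
  rewrite -E_sum; apply: eq_E => s; rewrite -E_sum; apply: eq_E => x2.
  by [].
apply: ler_E => [|s]; first by case: (pk u (f j)).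
rewrite -[X in X <= _](E_cst (best s) (pc u (f j) s)).
by apply: ler_E => // x2; case: (pc u (f j) s).
Qed.

Let ler_mean (T : finType) (F : T -> K) x : (0 < #|T|)%N ->
  (forall t, F t <= x) -> #|T|%:R^-1 * \sum_t F t <= x.
Proof.
move=> T_gt0 le_F; rewrite ler_pdivrMl ?ltr0n // mulr_natl -sumr_const.
exact: ler_sum.
Qed.

(** Decoding error and covering gap are averaged together, so that a single codebook is good for
    both; [best_enc2] then supplies the informed encoder. *)
Lemma one_shot_code :
  exists (e1 : Mc -> M1 -> X1) (e2 : S -> Mc -> X2) (d : Y -> Mc * M1),
  #|Mc|%:R^-1 * \sum_w #|M1|%:R^-1 * \sum_v
    E Q (fun s => E (W (e1 w v) (e2 s w) s) (fun y => (d y != (w, v))%:R))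
  <= jointE (fun u1 u2 x1 s x2 y => (~~ good u1 u2 x1 y)%:R)
     + (#|Mc| * #|M1| * #|J|)%:R / g3 + (#|M1| * #|J|)%:R / g2 + #|M1|%:R / g1
     + (jointE (fun u1 u2 x1 s x2 y => (h * Q s < k u1 u2 s)%R%:R)
        + eps + h / (4 * eps * #|J|%:R)).
Proof.
pose B1 := jointE (fun u1 u2 x1 s x2 y => (~~ good u1 u2 x1 y)%:R)
  + (#|Mc| * #|M1| * #|J|)%:R / g3 + (#|M1| * #|J|)%:R / g2 + #|M1|%:R / g1.
pose B2 := jointE (fun u1 u2 x1 s x2 y => (h * Q s < k u1 u2 s)%R%:R)
  + eps + h / (4 * eps * #|J|%:R).
pose bound C := #|Mc|%:R^-1 * \sum_w
  (#|M1|%:R^-1 * \sum_v #|J|%:R^-1 * \sum_j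
     E (VC C (w, v) j) (fun y => (decC C y != (w, v))%:R)
   + \sum_s gapC C w s).
have [C le_C] : exists C, bound C <= B1 + B2.
  apply: (E_exists_le prob_book); rewrite EZ E_sum; apply: ler_mean => // w.
  rewrite ED; apply: lerD.
    rewrite EZ E_sum; apply: ler_mean => // v.
    by rewrite EZ E_sum; apply: ler_mean.
  rewrite (E_prodm1 w (fun B : block => \sum_s covering_gap (a B.1.1) (k B.1.1) h eps B.1.2 s)) //.
  rewrite E_block /=.
  have -> : B2 = E p (fun u => E (a u) (fun u2 => E (k u u2) (fun s => (h * Q s < k u u2 s)%R%:R))
      + eps + h / (4 * eps * #|J|%:R)).
    rewrite !ED !E_cst //; congr (_ + _ + _); apply: eq_E => u; apply: eq_E => u2.
    rewrite -[RHS](E_cst _ (pb u)); apply: eq_E => x1; apply: eq_E => s.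
    by rewrite -[RHS](E_cst _ (pc u u2 s)); apply: eq_E => x2; rewrite E_cst.
  apply: ler_E => [|u]; first by case: pp.
  have pbM : prob (prodm (fun _ : M1 => b u)) by apply: prob_prodm.
  under eq_E do rewrite (E_cst _ pbM).
  have := mean_covering_gap (pa u) (pk u) h_ge0 eps_gt0 J_gt0.
  congr (_ <= _ + _ + _); apply: eq_E => u2; apply: eq_E => s.
  by rewrite /mix_out mixQ.
(* The trivial inequality only serves to extract an inhabitant of [X2]: laws of total mass one exist
   on non-empty alphabets only. *)
have [x0 _] : exists x : X2, 0 <= 0 :> K.
  have E0 (T : finType) (q : T -> K) : prob q -> exists x : T, 0 <= 0 :> K.
    by move=> pq; apply: (E_exists_le pq); rewrite E_cst.
  have [u1 _] := E0 _ _ pp; have [u2 _] := E0 _ _ (pa u1).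
  have [s _] := E0 _ _ (pk u1 u2); exact: E0 _ _ (pc u1 u2 s).
have [e2 le_e2] := best_enc2 C x0.
exists (fun w => (C w).2), e2, (decC C); apply: le_trans le_C.
apply: ler_wpM2l; first by rewrite invr_ge0.
apply: ler_sum => w _.
have M1_neq0 : #|M1|%:R != 0 :> K by rewrite pnatr_eq0 -lt0n.
rewrite -(ler_pM2l (x := #|M1|%:R)) ?ltr0n // mulVKf // mulrDr mulVKf //.
rewrite -E_sum; apply: le_trans (le_e2 w) _.
rewrite lerD2r -mulr_sumr exchange_big //.
Qed.

End Coding.
End OneShot.

(** * Tensor powers and Chernoff's bound *)

Section Tensor.
Variables (K : realFieldType) (I : finType).

Definition ffst (A B : finType) (h : {ffun I -> A * B}) := [ffun i => (h i).1].
Definition fsnd (A B : finType) (h : {ffun I -> A * B}) := [ffun i => (h i).2].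

(** Pairs of sequences correspond to sequences of pairs. The kernel [w'] is specified only pointwise
    because, after earlier merges, it reads its letters through projections of tuples. *)
Lemma E_prodm_pair (A B : finType) (q : A -> K) (w : A -> B -> K)
    (w' : {ffun I -> A} -> I -> B -> K) F :
  (forall f i, w' f i =1 w (f i)) ->
  E (prodm (fun=> q)) (fun f => E (prodm (w' f)) (F f))
  = E (prodm (fun=> pairm q w)) (fun h => F (ffst h) (fsnd h)).
Proof.
move=> eqw; rewrite /E; under eq_bigr do rewrite mulr_sumr.
rewrite pair_bigA.
rewrite (reindex (fun h : {ffun I -> A * B} => (ffst h, fsnd h))) /=; last first.
  exists (fun fg : {ffun I -> A} * {ffun I -> B} => [ffun i => (fg.1 i, fg.2 i)]) => [h _|[f g] _].
    by apply/ffunP => i; rewrite !ffunE -surjective_pairing.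
  by congr pair; apply/ffunP => i; rewrite !ffunE.
apply: eq_bigr => h _; rewrite mulrA; congr (_ * _).
rewrite /prodm -big_split; apply: eq_bigr => i _ /=.
by rewrite eqw /pairm !ffunE.
Qed.


Section Letters.
Variables (U1 U2 X1 X2 S Y : finType).
Variables (p : U1 -> K) (a : U1 -> U2 -> K) (b : U1 -> X1 -> K)
  (k : U1 -> U2 -> S -> K) (c : U1 -> U2 -> S -> X2 -> K)
  (W : X1 -> X2 -> S -> Y -> K).

Definition single_law : U1 * U2 * X1 * S * X2 * Y -> K :=
  pairm (pairm (pairm (pairm (pairm p a)
    (fun t => b t.1)) (fun t => k t.1.1 t.1.2))
    (fun t => c t.1.1.1 t.1.1.2 t.2)) (fun t => W t.1.1.2 t.2 t.1.2).

Lemma E_single_law h : E single_law h =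
  jointE p a b k c W (fun u1 u2 x1 s x2 y => h (u1, u2, x1, s, x2, y)).
Proof. by rewrite /single_law !E_pairm. Qed.

Let pn := prodm (fun _ : I => p).
Let an (u1 : {ffun I -> U1}) := prodm (fun i => a (u1 i)).
Let bn (u1 : {ffun I -> U1}) := prodm (fun i => b (u1 i)).
Let kn (u1 : {ffun I -> U1}) (u2 : {ffun I -> U2}) := prodm (fun i => k (u1 i) (u2 i)).
Let cn (u1 : {ffun I -> U1}) (u2 : {ffun I -> U2}) (s : {ffun I -> S}) :=
  prodm (fun i => c (u1 i) (u2 i) (s i)).
Let Wn (x1 : {ffun I -> X1}) (x2 : {ffun I -> X2}) (s : {ffun I -> S}) :=
  prodm (fun i => W (x1 i) (x2 i) (s i)).

Lemma chanV_tensor u1 u2 x1 y :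
  chanV kn cn Wn u1 u2 x1 y = \prod_i chanV k c W (u1 i) (u2 i) (x1 i) (y i).
Proof.
rewrite -E_prodm; apply: eq_E => s.
exact: (E_prodm (fun i => c (u1 i) (u2 i) (s i)) (fun i x2 => W (x1 i) x2 (s i) (y i))).
Qed.

Lemma out_u1u2_tensor u1 u2 y :
  out_u1u2 bn kn cn Wn u1 u2 y = \prod_i out_u1u2 b k c W (u1 i) (u2 i) (y i).
Proof. by rewrite -E_prodm; apply: eq_E => x1; apply: chanV_tensor. Qed.

Lemma out_u1_tensor u1 y :
  out_u1 an bn kn cn Wn u1 y = \prod_i out_u1 a b k c W (u1 i) (y i).
Proof. by rewrite -E_prodm; apply: eq_E => u2; apply: out_u1u2_tensor. Qed.

Lemma out_tensor y :
  out pn an bn kn cn Wn y = \prod_i out p a b k c W (y i).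
Proof. by rewrite -E_prodm; apply: eq_E => u1; apply: out_u1_tensor. Qed.

(** Five uses of [E_prodm_pair], each absorbing the next letter, turn the nested expectation into
    one over i.i.d. tuples, as required by [chernoff]. *)
Lemma jointE_tensor (h : {ffun I -> U1} -> {ffun I -> U2} -> {ffun I -> X1} ->
    {ffun I -> S} -> {ffun I -> X2} -> {ffun I -> Y} -> K)
    (h' : {ffun I -> U1 * U2 * X1 * S * X2 * Y} -> K) :
  (forall t, h' t = h [ffun i => (t i).1.1.1.1.1] [ffun i => (t i).1.1.1.1.2]
     [ffun i => (t i).1.1.1.2] [ffun i => (t i).1.1.2] [ffun i => (t i).1.2]
     [ffun i => (t i).2]) ->
  jointE pn an bn kn cn Wn h = E (prodm (fun _ : I => single_law)) h'.
Proof.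
move=> eqh; rewrite /jointE /pn /an.
rewrite (@E_prodm_pair _ _ _ a) // /bn.
rewrite (@E_prodm_pair _ _ _ (fun t => b t.1)); last by move=> f i x; rewrite !ffunE.
rewrite /kn (@E_prodm_pair _ _ _ (fun t => k t.1.1 t.1.2)); last first.
  by move=> f i x; rewrite !ffunE.
rewrite /cn (@E_prodm_pair _ _ _ (fun t => c t.1.1.1 t.1.1.2 t.2)); last first.
  by move=> f i x; rewrite !ffunE.
rewrite /Wn (@E_prodm_pair _ _ _ (fun t => W t.1.1.2 t.2 t.1.2)); last first.
  by move=> f i x; rewrite !ffunE.
apply: eq_E => t; rewrite eqh.
by congr h; apply/ffunP => i; rewrite !ffunE.
Qed.

End Letters.
End Tensor.

(** * The real exponential and Chernoff's bound *)

Local Arguments exp _%_ring_scope.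
Local Arguments ln _%_ring_scope.

Lemma exp_sum (J : Type) (r : seq J) (P : pred J) (F : J -> R) :
  exp (\sum_(i <- r | P i) F i) = \prod_(i <- r | P i) exp (F i).
Proof. by apply: (big_morph exp (fun x y => exp_plus x y) exp_0). Qed.

Lemma exp_ge1Dx (x : R) : 1 + x <= exp x.
Proof. by apply/RleP; apply: exp_ineq1_le. Qed.

Lemma exp_gt0 (x : R) : 0 < exp x.
Proof. by apply/RltP; apply: exp_pos. Qed.

Lemma expRN (x : R) : exp (- x) = (exp x)^-1.
Proof. by rewrite exp_Ropp. Qed.

Lemma ler_exp (x y : R) : (exp x <= exp y) = (x <= y).
Proof.
apply/idP/idP => /RleP le_xy; apply/RleP; last first.
  by case: le_xy => [/exp_increasing/Rlt_le //|->]; apply: Rle_refl.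
have [//|/exp_increasing lt_yx] := Rle_lt_dec x y.
by have := Rlt_not_le _ _ lt_yx; case.
Qed.

Lemma expM (x y : R) : exp x * exp y = exp (x + y).
Proof. exact: expRD. Qed.

(** Since [exp x] is at least [1 + x], it suffices that [(1 + x) * (1 - x + 2 * x ^+ 2)] is at least
    one; the excess is [x ^+ 2 * (1 + 2 * x)]. *)
Lemma exp_le_quadratic (x : R) : - 2^-1 <= x -> exp (- x) <= 1 - x + 2 * x ^+ 2.
Proof.
move=> x_ge; have := exp_ge1Dx x; have := exp_gt0 x; rewrite expRN => e0 e1.
rewrite -(ler_pM2l e0) mulfV ?gt_eqF //.
have q0 : 0 <= 1 - x + 2 * x ^+ 2 by nra.
apply: le_trans (ler_wpM2r q0 e1).
rewrite -subr_ge0.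
have -> : (1 + x) * (1 - x + 2 * x ^+ 2) - 1 = x ^+ 2 * (1 + 2 * x) by ring.
by rewrite mulr_ge0 ?sqr_ge0 //; lra.
Qed.

Section Chernoff.
Variables (T : finType) (P A B : T -> R).
Hypothesis pP : prob P.
Hypothesis AB_gt0 : forall t, 0 < P t -> 0 < A t /\ 0 < B t.

Definition mean_llr := E P (fun t => ln (A t / B t)).

(** On a finite alphabet the log-likelihood ratio is bounded, so for a small tilt [lam] its moment
    generating function is close to its linear part; Markov's inequality then gives a rate [rho]
    that does not depend on [n]. *)
Lemma chernoff delta : 0 < delta -> exists2 rho, 0 <= rho < 1 &
  forall n : nat,
  E (prodm (fun _ : 'I_n => P)) (fun f =>
    (\prod_i A (f i) <= exp (n%:R * (mean_llr - delta)) * \prod_i B (f i))%R%:R)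
  <= rho ^+ n.
Proof.
move=> delta_gt0; set D := mean_llr.
pose L t := ln (A t / B t).
(* A crude bound on all [L t], including default values of [ln] outside the support; the summand one
   ensures [M >= 1]. *)
pose M := 1 + \sum_t `|L t|.
have M_ge1 : 1 <= M by rewrite lerDl sumr_ge0.
have leM t : `|L t| <= M.
  by rewrite /M (bigD1 t) //= addrCA lerDl addr_ge0 ?sumr_ge0.
have den_gt0 : 0 < 4 * M ^+ 2 + 2 * M * delta by nra.
(* The denominator gives both [lam * M <= 1/2], the range of [exp_le_quadratic], and a quadratic
   term of at most [lam * (delta / 2)]. *)
pose lam := delta / (4 * M ^+ 2 + 2 * M * delta).
have lam_gt0 : 0 < lam by rewrite divr_gt0.
have lamE : lam * (4 * M ^+ 2 + 2 * M * delta) = delta by rewrite divfK ?gt_eqF.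
have lamM : lam * M <= 2^-1.
  rewrite -(ler_pM2r den_gt0) mulrAC lamE; nra.
have lamM2 : 2 * lam * M ^+ 2 <= delta / 2.
  have -> : 2 * lam * M ^+ 2 = lam * (4 * M ^+ 2) / 2 by field.
  rewrite ler_pM2r ?invr_gt0 // -[X in _ <= X]lamE ler_pM2l //; nra.
have expL t : exp (- (lam * L t)) <= 1 - lam * L t + 2 * lam ^+ 2 * M ^+ 2.
  have := leM t; rewrite ler_norml => /andP[L1 L2].
  have lamL : - 2^-1 <= lam * L t.
    by have := ler_wpM2l (ltW lam_gt0) L1; rewrite mulrN; lra.
  apply: le_trans (exp_le_quadratic lamL) _.
  rewrite lerD2l -mulrA ler_pM2l // exprMn ler_wpM2l ?sqr_ge0 //.
  by rewrite -subr_ge0 subr_sqr mulr_ge0 //; lra.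
have EexpL : E P (fun t => exp (- (lam * L t))) <= exp (lam * (delta / 2) - lam * D).
  apply: (@le_trans _ _ (1 + (2 * lam ^+ 2 * M ^+ 2 - lam * D))); last first.
    apply: le_trans (exp_ge1Dx _) _; rewrite ler_exp lerD2r.
    have -> : 2 * lam ^+ 2 * M ^+ 2 = lam * (2 * lam * M ^+ 2) by ring.
    by rewrite ler_pM2l.
  apply: (@le_trans _ _ (E P (fun t => 1 - lam * L t + 2 * lam ^+ 2 * M ^+ 2))).
    by apply: ler_E => [|t]; [case: pP|apply: expL].
  by rewrite ED EB EZ !E_cst // -/D /D /mean_llr -/L; lra.
exists (exp (- (lam * (delta / 2)))).
  rewrite ltW ?exp_gt0 //= -[X in _ < X]exp_0 ltNge ler_exp -ltNge.
  have : 0 < lam * (delta / 2) by rewrite !mulr_gt0 ?invr_gt0 ?ltr0n.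
  by rewrite oppr_lt0.
move=> n.
have -> : exp (- (lam * (delta / 2))) ^+ n =
    exp (n%:R * (lam * (D - delta))) * \prod_(i < n) exp (lam * (delta / 2) - lam * D).
  rewrite prodr_const card_ord expRX expRX expRD; congr exp.
  by rewrite -[LHS]mulr_natl -[X in _ = _ + X]mulr_natl; field.
apply: (@le_trans _ _ (exp (n%:R * (lam * (D - delta))) *
   \prod_(i < n) E P (fun t => exp (- (lam * L t))))); last first.
  rewrite ler_pM2l ?exp_gt0 //; apply: ler_prod => i _; rewrite EexpL andbT.
  by apply: E_ge0 => [|t]; [case: pP|rewrite ltW // exp_gt0].
rewrite -(E_prodm (fun _ : 'I_n => P) (fun _ t => exp (- (lam * L t)))) -EZ.
(* Markov's inequality in pointwise form: the indicator is dominated by the exponential of the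
   tilted sum. Sequences of probability zero go first, as the ratios are known to be positive on the
   support only. *)
apply: ler_sum => f _.
have [P0 _] := pP.
have [Pf0|Pf_neq0] := eqVneq (prodm (fun=> P) f) 0; first by rewrite Pf0 !mul0r.
apply: ler_wpM2l; first by apply: prodr_ge0.
case: (boolP (\prod_i A (f i) <= _)) => [le_AB|_] /=; last first.
  by rewrite mulr_ge0 ?prodr_ge0 // => *; rewrite ltW // exp_gt0.
have Pf i : 0 < P (f i).
  rewrite lt_def P0 andbT; apply: contraNneq Pf_neq0 => Pf0.
  by rewrite /prodm (bigD1 i) //= Pf0 mul0r.
rewrite -exp_sum expRD -[X in X <= _]exp_0 ler_exp sumrN -mulr_sumr.
suff : \sum_i L (f i) <= n%:R * (D - delta).
  by move=> /(ler_wpM2l (ltW lam_gt0)) le_sum; rewrite subr_ge0 mulrCA.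
rewrite -ler_exp exp_sum.
have B_gt0 : 0 < \prod_i B (f i).
  by apply: prodr_gt0 => i _; have [] := AB_gt0 (Pf i).
rewrite -(ler_pM2r B_gt0) -big_split /=.
apply: le_trans le_AB; rewrite le_eqVlt; apply/orP; left; apply/eqP.
apply: eq_bigr => i _; have [A0 B0] := AB_gt0 (Pf i).
rewrite /L exp_ln ?divfK ?gt_eqF //.
by apply/RltP; rewrite divr_gt0.
Qed.

End Chernoff.

(** * Information quantities of the single-letter law *)

Lemma rsumE (T : finType) (f : T -> R) : rsum f = \sum_x f x.
Proof. by []. Qed.

Lemma is_pmfP (T : finType) (p : T -> R) : is_pmf p <-> prob p.
Proof. by split=> -[p0 p1]; split=> // x; apply/RleP; apply: p0. Qed.

Lemma margE (T A : finType) (p : T -> R) (f : T -> A) v :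
  marg p f v = E p (fun t => (f t == v)%:R).
Proof.
rewrite /E [LHS]big_mkcond; apply: eq_bigr => t _.
by case: (f t == v); rewrite ?mulr1 ?mulr0.
Qed.

Lemma ln2_gt0 : 0 < ln (IZR 2).
Proof.
apply/RltP; have := ln_increasing 1 (IZR 2) Rlt_0_1; rewrite ln_1; apply.
exact: (IZR_lt 1 2).
Qed.

(** The sum over values becomes a mean over sample points, in nats; the zero convention is harmless
    because the weight vanishes there. *)
Lemma cmiE (T A B C : finType) (p : T -> R)
    (fa : T -> A) (fb : T -> B) (fc : T -> C) :
  cmi p fa fb fc * ln (IZR 2) = E p (fun t =>
    ln (marg p (fun t => (fa t, fb t, fc t)) (fa t, fb t, fc t) * marg p fc (fc t)
       / (marg p (fun t => (fa t, fc t)) (fa t, fc t)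
          * marg p (fun t => (fb t, fc t)) (fb t, fc t)))).
Proof.
pose r (v : A * B * C) :=
  ln (marg p (fun t => (fa t, fb t, fc t)) v * marg p fc v.2
     / (marg p (fun t => (fa t, fc t)) (v.1.1, v.2)
        * marg p (fun t => (fb t, fc t)) (v.1.2, v.2))).
transitivity (\sum_v marg p (fun t => (fa t, fb t, fc t)) v * r v).
  rewrite /cmi rsumE mulr_suml.
  apply: eq_bigr => -[[x y] z] _ /=.
  case: Req_dec_T => [pv0|_] /=; first by rewrite pv0 !mul0r.
  have ln2 : ln (IZR 2) != 0 by rewrite gt_eqF // ln2_gt0.
  by rewrite -[LHS]mulrA /log2 !RealsE divfK // /r /= !RealsE.
transitivity (\sum_v E p (fun t => ((fa t, fb t, fc t) == v)%:R * r v)).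
  by apply: eq_bigr => v _; rewrite EZr margE.
rewrite -E_sum; apply: eq_E => t.
rewrite (bigD1 (fa t, fb t, fc t)) //= eqxx mul1r big1 ?addr0 // => v.
by rewrite eq_sym => /negPf ->; rewrite mul0r.
Qed.

Section SingleLetter.
Variables (S U1 U2 X1 X2 Y : finType).
Variables (QS : S -> R) (p : U1 -> R) (b : U1 -> X1 -> R)
  (PU2 : U1 -> S -> U2 -> R) (PX2 : U1 -> U2 -> S -> X2 -> R)
  (W : X1 -> X2 -> S -> Y -> R).
Hypotheses (pQ : prob QS) (pp : prob p) (pb : forall u1, prob (b u1))
  (pPU2 : forall u1 s, prob (PU2 u1 s)) (pc : forall u1 u2 s, prob (PX2 u1 u2 s))
  (pW : forall x1 x2 s, prob (W x1 x2 s)).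

(* [aux2] is P(u2 | u1) and [post] is P(s | u1, u2); the value of [post] where
   [aux2] vanishes is immaterial but must be a distribution. *)
Definition aux2 u1 u2 : R := E QS (fun s => PU2 u1 s u2).

Definition post u1 u2 s : R :=
  if aux2 u1 u2 == 0 then QS s else QS s * PU2 u1 s u2 / aux2 u1 u2.

Lemma prob_aux2 u1 : prob (aux2 u1).
Proof. exact: prob_channel_mix. Qed.

(** Bayes' rule. Where [aux2] vanishes, so does each of the nonnegative terms that it sums. *)
Lemma aux2_post u1 u2 s : aux2 u1 u2 * post u1 u2 s = QS s * PU2 u1 s u2.
Proof.
have [Q0 _] := pQ; have P0 u s' : 0 <= PU2 u1 s' u by case: (pPU2 u1 s').
rewrite /post; have [a0|a0] := eqVneq (aux2 u1 u2) 0; last by rewrite mulrC divfK.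
rewrite a0 mul0r; apply/esym/eqP; move/eqP: a0.
rewrite psumr_eq0 => [/allP/(_ s (mem_index_enum s)) //|s' _].
by rewrite mulr_ge0.
Qed.

Lemma prob_post u1 u2 : prob (post u1 u2).
Proof.
have [Q0 Q1] := pQ; have [a0 _] := prob_aux2 u1.
rewrite /post; have [//|aneq0] := eqVneq (aux2 u1 u2) 0.
split=> [s|]; last by rewrite -mulr_suml divff.
by rewrite !mulr_ge0 ?invr_ge0 //; case: (pPU2 u1 s).
Qed.

Lemma mix_post u1 s : E (aux2 u1) (fun u2 => post u1 u2 s) = QS s.
Proof.
rewrite -[RHS]mulr1; have [_ <-] := pPU2 u1 s; rewrite mulr_sumr.
by apply: eq_bigr => u2 _; rewrite aux2_post.
Qed.

Let a := aux2.
Let k := post.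
Let c := PX2.
Let pa := prob_aux2.
Let pk := prob_post.

Let law := single_law p a b k c W.
Let J := joint QS p b PU2 PX2 W.

Lemma prob_single_law : prob law.
Proof. by do ![apply: prob_pairm => // *]; rewrite /= /k /c /a. Qed.

Let reorder (t : U1 * U2 * X1 * S * X2 * Y) : S * U1 * U2 * X1 * X2 * Y :=
  let '(u1, u2, x1, s, x2, y) := t in (s, u1, u2, x1, x2, y).

(** By Bayes' rule the law of the theorem is the idealised law with its coordinates reordered. *)
Lemma E_joint F : E J F = E law (fun t => F (reorder t)).
Proof.
rewrite /E (reindex reorder) /=; last first.
  by exists (fun t => let '(s, u1, u2, x1, x2, y) := t in (u1, u2, x1, s, x2, y));
     move=> [[[[[? ?] ?] ?] ?] ?].
apply: eq_bigr => -[[[[[u1 u2] x1] s] x2] y] _; congr (_ * _).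
rewrite /J /joint /law /single_law /pairm /= !RealsE.
have := aux2_post u1 u2 s; rewrite -/a -/k => eq_ak.
rewrite [RHS](_ : _ = a u1 u2 * k u1 u2 s * (p u1 * b u1 x1 * c u1 u2 s x2 * W x1 x2 s y)).
  by rewrite eq_ak /c; ring.
by ring.
Qed.

(** A common form for all marginals needed: each factor is [at_] for a fixed coordinate and [any]
    for a summed one. The coordinate [x2] is always summed. *)
Let J5 (c1 : U1 -> R) (c2 : U2 -> R) (c3 : X1 -> R) (c4 : S -> R) (c5 : Y -> R) :=
  E p (fun u1 => c1 u1 * E (a u1) (fun u2 => c2 u2 * E (b u1) (fun x1 => c3 x1 *
    E (k u1 u2) (fun s => c4 s * E (c u1 u2 s) (fun x2 => E (W x1 x2 s) c5))))).

Let marg_joint (A : finType) (f : _ -> A) v c1 c2 c3 c4 c5 :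
  (forall s u1 u2 x1 x2 y, (f (s, u1, u2, x1, x2, y) == v)%:R
     = c1 u1 * c2 u2 * c3 x1 * c4 s * c5 y) ->
  marg J f v = J5 c1 c2 c3 c4 c5.
Proof.
move=> eqf; rewrite margE E_joint E_single_law.
apply: eq_E => u1; rewrite -EZ; apply: eq_E => u2; rewrite -EZ -EZ.
apply: eq_E => x1; rewrite -!EZ; apply: eq_E => s; rewrite -!EZ.
by apply: eq_E => x2; rewrite -!EZ; apply: eq_E => y; rewrite eqf; ring.
Qed.

Let at_ (T : finType) (v : T) : T -> R := fun x => (x == v)%:R.
Let any (T : finType) : T -> R := fun=> 1.

Let EcW_any u1 u2 s x1 : E (c u1 u2 s) (fun x2 => E (W x1 x2 s) (@any Y)) = 1.
Proof. by under eq_E do rewrite E_cst //; rewrite E_cst. Qed.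

Let J5_y u1 u2 x1 y :
  E (k u1 u2) (fun s => any s * E (c u1 u2 s) (fun x2 => E (W x1 x2 s) (at_ y)))
  = chanV k c W u1 u2 x1 y.
Proof.
apply: eq_E => s; rewrite mul1r; apply: eq_E => x2; exact: E_pick1.
Qed.

Let q1 := out_u1u2 b k c W.
Let q2 := out_u1 a b k c W.
Let q3 := out p a b k c W.

Let J5_full u1 u2 x1 y : J5 (at_ u1) (at_ u2) (at_ x1) (@any S) (at_ y)
  = p u1 * (a u1 u2 * (b u1 x1 * chanV k c W u1 u2 x1 y)).
Proof. by rewrite /J5 !E_pick J5_y. Qed.

Let J5_u1u2x1 u1 u2 x1 : J5 (at_ u1) (at_ u2) (at_ x1) (@any S) (@any Y)
  = p u1 * (a u1 u2 * b u1 x1).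
Proof.
rewrite /J5 !E_pick; under eq_E do rewrite EcW_any mulr1.
by rewrite E_cst ?mulr1 //; apply: pk.
Qed.

Let Ek_any u1 u2 x1 :
  E (k u1 u2) (fun s => any s * E (c u1 u2 s) (fun x2 => E (W x1 x2 s) (@any Y))) = 1.
Proof. by under eq_E do rewrite EcW_any mulr1; rewrite E_cst //; apply: pk. Qed.

Let J5_u1u2 u1 u2 : J5 (at_ u1) (at_ u2) (@any X1) (@any S) (@any Y) = p u1 * a u1 u2.
Proof.
rewrite /J5 !E_pick; under eq_E do rewrite Ek_any mulr1.
by rewrite E_cst ?mulr1.
Qed.

Let J5_u1 u1 : J5 (at_ u1) (@any U2) (@any X1) (@any S) (@any Y) = p u1.
Proof.
rewrite /J5 E_pick; under eq_E do under eq_E do rewrite Ek_any mulr1.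
under eq_E do rewrite E_cst // mulr1.
by rewrite E_cst ?mulr1 //; apply: pa.
Qed.

Let J5_0 : J5 (@any U1) (@any U2) (@any X1) (@any S) (@any Y) = 1.
Proof.
rewrite /J5; under eq_E do under eq_E do under eq_E do rewrite Ek_any mulr1.
under eq_E do under eq_E do rewrite E_cst // mulr1.
by under eq_E do rewrite E_cst ?mulr1 ?pa //; rewrite E_cst.
Qed.

Let J5_u1u2y u1 u2 y : J5 (at_ u1) (at_ u2) (@any X1) (@any S) (at_ y)
  = p u1 * (a u1 u2 * q1 u1 u2 y).
Proof. by rewrite /J5 !E_pick; under eq_E do rewrite J5_y mul1r. Qed.

Let J5_u1y u1 y : J5 (at_ u1) (@any U2) (@any X1) (@any S) (at_ y) = p u1 * q2 u1 y.
Proof.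
rewrite /J5 E_pick; under eq_E do under eq_E do rewrite J5_y mul1r.
by under eq_E do rewrite mul1r.
Qed.

Let J5_ y : J5 (@any U1) (@any U2) (@any X1) (@any S) (at_ y) = q3 y.
Proof.
rewrite /J5; under eq_E do under eq_E do under eq_E do rewrite J5_y mul1r.
by under eq_E do under eq_E do rewrite mul1r; under eq_E do rewrite mul1r.
Qed.

Let Ek_s u1 u2 x1 s :
  E (k u1 u2) (fun s' => at_ s s' * E (c u1 u2 s') (fun x2 => E (W x1 x2 s') (@any Y)))
  = k u1 u2 s.
Proof. by under eq_E do rewrite EcW_any mulr1; rewrite E_pick1. Qed.

Let J5_u1u2s u1 u2 s : J5 (at_ u1) (at_ u2) (@any X1) (at_ s) (@any Y)
  = p u1 * (a u1 u2 * k u1 u2 s).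
Proof.
by rewrite /J5 !E_pick; under eq_E do rewrite Ek_s mul1r; rewrite E_cst.
Qed.

Let J5_u1s u1 s : J5 (at_ u1) (@any U2) (@any X1) (at_ s) (@any Y) = p u1 * QS s.
Proof.
rewrite /J5 E_pick; under eq_E do under eq_E do rewrite Ek_s mul1r.
by under eq_E do rewrite mul1r E_cst //; rewrite mix_post.
Qed.

(** Positivity on the support, both to cancel factors inside logarithms and to meet the hypothesis
    of [chernoff]. *)
Lemma single_law_gt0 u1 u2 x1 s x2 y : 0 < law (u1, u2, x1, s, x2, y) ->
  [/\ [/\ 0 < p u1, 0 < a u1 u2 & 0 < b u1 x1], 0 < k u1 u2 s,
      0 < QS s,
      0 < chanV k c W u1 u2 x1 y &
      [/\ 0 < q1 u1 u2 y, 0 < q2 u1 y & 0 < q3 y]].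
Proof.
have p0 u : 0 <= p u by case: pp.
have a0 u v : 0 <= a u v by case: (pa u).
have b0 u x : 0 <= b u x by case: (pb u).
have k0 u v z : 0 <= k u v z by case: (pk u v).
have c0 u v z x : 0 <= c u v z x by case: (pc u v z).
have W0 x x' z v : 0 <= W x x' z v by case: (pW x x' z).
have V0 u v x z : 0 <= chanV k c W u v x z.
  by apply: E_ge0 => // ?; apply: E_ge0.
have q10 u v z : 0 <= q1 u v z by apply: E_ge0.
have q20 u z : 0 <= q2 u z by apply: E_ge0.
rewrite /law /single_law /pairm /=.
move=> /lt0r_neq0; rewrite !mulf_eq0 !negb_or.
move=> /andP[/andP[/andP[/andP[/andP[np na] nb] nk] nc] nW].
have pu : 0 < p u1 by rewrite lt0r np p0.
have au : 0 < a u1 u2 by rewrite lt0r na a0.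
have bx : 0 < b u1 x1 by rewrite lt0r nb b0.
have ks : 0 < k u1 u2 s by rewrite lt0r nk k0.
have cx : 0 < c u1 u2 s x2 by rewrite lt0r nc c0.
have Wy : 0 < W x1 x2 s y by rewrite lt0r nW W0.
have Qs : 0 < QS s by rewrite -(mix_post u1); apply: (E_gt0 (x := u2)).
have Vy : 0 < chanV k c W u1 u2 x1 y.
  apply: (E_gt0 (x := s)) => // [z|]; first exact: E_ge0.
  exact: (E_gt0 (x := x2)).
have q1y : 0 < q1 u1 u2 y by apply: (E_gt0 (x := x1)).
have q2y : 0 < q2 u1 y by apply: (E_gt0 (x := u2)).
have q3y : 0 < q3 y by apply: (E_gt0 (x := u1)).
by [].
Qed.

Let law_ge0 t : 0 <= law t. Proof. by case: prob_single_law. Qed.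

Let marg_eq (A : finType) (f : _ -> A) v c1 c2 c3 c4 c5 x :
  J5 c1 c2 c3 c4 c5 = x ->
  (forall s u1 u2 x1 x2 y, (f (s, u1, u2, x1, x2, y) == v)%:R
     = c1 u1 * c2 u2 * c3 x1 * c4 s * c5 y) ->
  marg J f v = x.
Proof. by move=> <- /marg_joint ->. Qed.

Ltac indic := by move=> *; rewrite /= /at_ /any ?xpair_eqE /= ?(eqxx tt);
  do ?[case: (_ == _)]; rewrite /= ?(mulr1, mul1r, mulr0, mul0r).

Let Vt (t : U1 * U2 * X1 * S * X2 * Y) :=
  chanV k c W t.1.1.1.1.1 t.1.1.1.1.2 t.1.1.1.2 t.2.

(** Once the marginals are factored along the law, [p], [a] and [b] cancel and only the ratio of
    [chanV] to an output law remains; likewise in the next two lemmas. *)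
Lemma cmi_x1 :
  cmi J (@pX1 S U1 U2 X1 X2 Y) (@pY S U1 U2 X1 X2 Y) (fun t => (pU1 t, pU2 t))
    * ln (IZR 2)
  = mean_llr law Vt (fun t => q1 t.1.1.1.1.1 t.1.1.1.1.2 t.2).
Proof.
rewrite cmiE E_joint; apply: eq_E_supp => // -[[[[[u1 u2] x1] s] x2] y].
move=> /single_law_gt0[[p0 a0 b0] _ _ V0 [q0 _ _]].
transitivity (ln (p u1 * (a u1 u2 * (b u1 x1 * chanV k c W u1 u2 x1 y))
  * (p u1 * a u1 u2) / (p u1 * (a u1 u2 * b u1 x1) * (p u1 * (a u1 u2 * q1 u1 u2 y))))).
  congr (ln (_ * _ / (_ * _))).
  - apply: (marg_eq (J5_full u1 u2 x1 y)); indic.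
  - apply: (marg_eq (J5_u1u2 u1 u2)); indic.
  - apply: (marg_eq (J5_u1u2x1 u1 u2 x1)); indic.
  - apply: (marg_eq (J5_u1u2y u1 u2 y)); indic.
by congr ln; rewrite /Vt /=; field; rewrite !gt_eqF.
Qed.

Lemma cmi_x1u2 :
  cmi J (fun t => (pX1 t, pU2 t)) (@pY S U1 U2 X1 X2 Y) (@pU1 S U1 U2 X1 X2 Y)
    * ln (IZR 2)
  = mean_llr law Vt (fun t => q2 t.1.1.1.1.1 t.2).
Proof.
rewrite cmiE E_joint; apply: eq_E_supp => // -[[[[[u1 u2] x1] s] x2] y].
move=> /single_law_gt0[[p0 a0 b0] _ _ V0 [_ q0 _]].
transitivity (ln (p u1 * (a u1 u2 * (b u1 x1 * chanV k c W u1 u2 x1 y))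
  * p u1 / (p u1 * (a u1 u2 * b u1 x1) * (p u1 * q2 u1 y)))).
  congr (ln (_ * _ / (_ * _))).
  - apply: (marg_eq (J5_full u1 u2 x1 y)); indic.
  - apply: (marg_eq (J5_u1 u1)); indic.
  - apply: (marg_eq (J5_u1u2x1 u1 u2 x1)); indic.
  - apply: (marg_eq (J5_u1y u1 y)); indic.
by congr ln; rewrite /Vt /=; field; rewrite !gt_eqF.
Qed.

Lemma mi_x1u1u2 :
  mi J (fun t => (pX1 t, pU1 t, pU2 t)) (@pY S U1 U2 X1 X2 Y) * ln (IZR 2)
  = mean_llr law Vt (fun t => q3 t.2).
Proof.
rewrite /mi cmiE E_joint; apply: eq_E_supp => // -[[[[[u1 u2] x1] s] x2] y].
move=> /single_law_gt0[[p0 a0 b0] _ _ V0 [_ _ q0]].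
transitivity (ln (p u1 * (a u1 u2 * (b u1 x1 * chanV k c W u1 u2 x1 y))
  * 1 / (p u1 * (a u1 u2 * b u1 x1) * q3 y))).
  congr (ln (_ * _ / (_ * _))).
  - apply: (marg_eq (J5_full u1 u2 x1 y)); indic.
  - apply: (marg_eq J5_0); indic.
  - apply: (marg_eq (J5_u1u2x1 u1 u2 x1)); indic.
  - apply: (marg_eq (J5_ y)); indic.
by congr ln; rewrite /Vt /=; field; rewrite !gt_eqF.
Qed.

Let kt (t : U1 * U2 * X1 * S * X2 * Y) := k t.1.1.1.1.1 t.1.1.1.1.2 t.1.1.2.
Let Qt (t : U1 * U2 * X1 * S * X2 * Y) := QS t.1.1.2.

(** The ratio is written as [QS] over [k], whence the sign: [chernoff] controls small ratios, and
    the exceptional event for covering is a large [k]. *)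
Lemma cmi_u2s :
  cmi J (@pU2 S U1 U2 X1 X2 Y) (@pS S U1 U2 X1 X2 Y) (@pU1 S U1 U2 X1 X2 Y)
    * ln (IZR 2)
  = - mean_llr law Qt kt.
Proof.
rewrite cmiE E_joint -mulN1r -EZ; apply: eq_E_supp => // -[[[[[u1 u2] x1] s] x2] y].
move=> /single_law_gt0[[p0 a0 b0] k0 Q0 _ _].
transitivity (ln (p u1 * (a u1 u2 * k u1 u2 s)
  * p u1 / (p u1 * a u1 u2 * (p u1 * QS s)))).
  congr (ln (_ * _ / (_ * _))).
  - apply: (marg_eq (J5_u1u2s u1 u2 s)); indic.
  - apply: (marg_eq (J5_u1 u1)); indic.
  - apply: (marg_eq (J5_u1u2 u1 u2)); indic.
  - apply: (marg_eq (J5_u1s u1 s)); indic.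
have Qk : (0 < QS s / k u1 u2 s) by rewrite divr_gt0.
rewrite mulN1r -[RHS]ln_Rinv; last exact/RltP.
by congr ln; rewrite /Qt /kt /= !RealsE; field; rewrite !gt_eqF.
Qed.

(** Nonnegativity of I(U2; S | U1): [ln x <= x - 1], and the mean of [QS / k] is at most one. It
    makes the list rate chosen later nonnegative. *)
Lemma mean_llr_QS_le0 : mean_llr law Qt kt <= 0.
Proof.
have [_ law1] := prob_single_law.
have le1 : E law (fun t => Qt t / kt t) <= 1.
  rewrite E_single_law /kt /Qt /=.
  apply: (E_le_cst pp) => u1; apply: (E_le_cst (pa u1)) => u2.
  apply: (E_le_cst (pb u1)) => x1.
  have [Q0 <-] := pQ; apply: ler_sum => s _.
  have -> : E (c u1 u2 s) (fun x2 => E (W x1 x2 s) (fun=> QS s / k u1 u2 s))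
      = QS s / k u1 u2 s.
    by rewrite -[RHS](E_cst _ (pc u1 u2 s)); apply: eq_E => x2; rewrite E_cst.
  have [->|k_neq0] := eqVneq (k u1 u2 s) 0; first by rewrite mul0r.
  by rewrite mulrC divfK.
apply: (@le_trans _ _ (E law (fun t => Qt t / kt t - 1))); last first.
  by rewrite EB E_cst ?subr_le0 //; apply: prob_single_law.
apply: ler_sum => -[[[[[u1 u2] x1] s] x2] y] _.
set t := (_, y).
have [->|law_neq0] := eqVneq (law t) 0; first by rewrite !mul0r.
have law_gt0 : 0 < law t by rewrite lt0r law_neq0 law_ge0.
rewrite ler_pM2l // lerBrDl.
have [_ k_gt0 Q_gt0 _ _] := single_law_gt0 law_gt0.
have Qk : 0 < Qt t / kt t by rewrite divr_gt0.
by have := exp_ge1Dx (ln (Qt t / kt t)); rewrite exp_ln //; apply/RltP.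
Qed.

(** * Codes of block length [n] *)

Let D0 := mean_llr law Qt kt.
Let D1 := mean_llr law Vt (fun t => q1 t.1.1.1.1.1 t.1.1.1.1.2 t.2).
Let D2 := mean_llr law Vt (fun t => q2 t.1.1.1.1.1 t.2).
Let D3 := mean_llr law Vt (fun t => q3 t.2).

(** The one-shot bound on sequences, each threshold lying [delta] per letter inside the
    corresponding mean; [rho] is fixed before the block length and the message counts. *)
Lemma block_code delta : 0 < delta -> exists2 rho : R, 0 <= rho < 1 &
  forall (n Mc M1 L : nat) (eps : R),
  (0 < Mc)%N -> (0 < M1)%N -> (0 < L)%N -> 0 < eps ->
  exists cd : code S X1 X2 Y n Mc M1,
  err_prob QS W cd <= 4 * rho ^+ n
    + (Mc * M1 * L)%:R / exp (n%:R * (D3 - delta))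
    + (M1 * L)%:R / exp (n%:R * (D2 - delta))
    + M1%:R / exp (n%:R * (D1 - delta))
    + eps + exp (- (n%:R * (D0 - delta))) / (4 * eps * L%:R).
Proof.
move=> delta_gt0.
have supp t : 0 < law t -> [/\ 0 < Vt t, 0 < kt t, 0 < Qt t &
    [/\ 0 < q1 t.1.1.1.1.1 t.1.1.1.1.2 t.2, 0 < q2 t.1.1.1.1.1 t.2 & 0 < q3 t.2]].
  by case: t => [[[[[u1 u2] x1] s] x2] y] /single_law_gt0[_ ? ? ? [? ? ?]].
have supp0 t : 0 < law t -> 0 < Qt t /\ 0 < kt t by case/supp.
have supp1 t : 0 < law t -> 0 < Vt t /\ 0 < q1 t.1.1.1.1.1 t.1.1.1.1.2 t.2.
  by case/supp=> ? _ _ [].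
have supp2 t : 0 < law t -> 0 < Vt t /\ 0 < q2 t.1.1.1.1.1 t.2.
  by case/supp=> ? _ _ [].
have supp3 t : 0 < law t -> 0 < Vt t /\ 0 < q3 t.2 by case/supp=> ? _ _ [].
have [r0 r0P ch0] := chernoff prob_single_law supp0 delta_gt0.
have [r1 r1P ch1] := chernoff prob_single_law supp1 delta_gt0.
have [r2 r2P ch2] := chernoff prob_single_law supp2 delta_gt0.
have [r3 r3P ch3] := chernoff prob_single_law supp3 delta_gt0.
pose rho := Num.max (Num.max r0 r1) (Num.max r2 r3).
have r_ge0 x : 0 <= x < 1 -> 0 <= x by case/andP.
exists rho.
  move: r0P r1P r2P r3P => /andP[h0 l0] /andP[_ l1] /andP[_ l2] /andP[_ l3].
  by rewrite /rho !le_max !gt_max h0 l0 l1 l2 l3.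
move=> n Mc M1 L eps Mc_gt0 M1_gt0 L_gt0 eps_gt0.
have rX x : 0 <= x < 1 -> x <= rho -> x ^+ n <= rho ^+ n.
  by move=> /r_ge0 x0 le_x; rewrite lerXn2r ?nnegrE // (le_trans x0).
have le0 : r0 ^+ n <= rho ^+ n by apply: rX => //; rewrite !le_max lexx.
have le1 : r1 ^+ n <= rho ^+ n by apply: rX => //; rewrite !le_max lexx ?orbT.
have le2 : r2 ^+ n <= rho ^+ n by apply: rX => //; rewrite !le_max lexx ?orbT.
have le3 : r3 ^+ n <= rho ^+ n by apply: rX => //; rewrite !le_max lexx ?orbT.
pose pn := prodm (fun _ : 'I_n => p).
pose an (u1 : {ffun 'I_n -> U1}) := prodm (fun i => a (u1 i)).
pose bn (u1 : {ffun 'I_n -> U1}) := prodm (fun i => b (u1 i)).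
pose kn (u1 : {ffun 'I_n -> U1}) (u2 : {ffun 'I_n -> U2}) :=
  prodm (fun i => k (u1 i) (u2 i)).
pose cn (u1 : {ffun 'I_n -> U1}) (u2 : {ffun 'I_n -> U2}) (s : {ffun 'I_n -> S}) :=
  prodm (fun i => c (u1 i) (u2 i) (s i)).
pose Wn (x1 : {ffun 'I_n -> X1}) (x2 : {ffun 'I_n -> X2}) (s : {ffun 'I_n -> S}) :=
  prodm (fun i => W (x1 i) (x2 i) (s i)).
pose Qn := prodm (fun _ : 'I_n => QS).
have ppn : prob pn by apply: prob_prodm.
have pan u1 : prob (an u1) by apply: prob_prodm => i; apply: pa.
have pbn u1 : prob (bn u1) by apply: prob_prodm.
have pkn u1 u2 : prob (kn u1 u2) by apply: prob_prodm => i; apply: pk.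
have pcn u1 u2 s : prob (cn u1 u2 s) by apply: prob_prodm => i; apply: pc.
have pWn x1 x2 s : prob (Wn x1 x2 s) by apply: prob_prodm.
have mixn u1 s : E (an u1) (fun u2 => kn u1 u2 s) = Qn s.
  rewrite (E_prodm (fun i => a (u1 i)) (fun i u2 => k (u1 i) u2 (s i))).
  by apply: eq_bigr => i _; apply: mix_post.
have card_gt0 m : (0 < m)%N -> (0 < #|'I_m|)%N by rewrite card_ord.
have [e1 [e2 [d le_d]]] := one_shot_code ppn pan pbn pkn pcn pWn mixn
  (exp_gt0 (n%:R * (D1 - delta))) (exp_gt0 (n%:R * (D2 - delta)))
  (exp_gt0 (n%:R * (D3 - delta))) (ltW (exp_gt0 (- (n%:R * (D0 - delta)))))
  eps_gt0 (card_gt0 _ Mc_gt0) (card_gt0 _ M1_gt0) (card_gt0 _ L_gt0).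
exists (Code e1 e2 d).
have -> : err_prob QS W (Code e1 e2 d) =
   #|'I_Mc|%:R^-1 * \sum_w #|'I_M1|%:R^-1 * \sum_v
    E Qn (fun s => E (Wn (e1 w v) (e2 s w) s) (fun y => (d y != (w, v))%:R)).
  rewrite /err_prob rsumE mulr_sumr; apply: eq_bigr => w _.
  rewrite rsumE mulrA mulr_sumr; apply: eq_bigr => v _.
  rewrite rsumE mulr_sumr; apply: eq_bigr => s _.
  rewrite rsumE mulrA mulr_sumr; apply: eq_bigr => y _.
  rewrite !card_ord !RealsE natrM invfM !mulrA; congr (_ * _).
  by case: (_ == _).
apply: le_trans le_d _; rewrite !card_ord.
(* A triple that is not good fails one of three thresholds; each failure is a Chernoff event once
   the output laws are factored into letters. *)
have jb : jointE pn an bn kn cn Wn (fun u1 u2 x1 s x2 y =>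
    (~~ good pn an bn kn cn Wn (exp (n%:R * (D1 - delta)))
       (exp (n%:R * (D2 - delta))) (exp (n%:R * (D3 - delta))) u1 u2 x1 y)%:R)
    <= r1 ^+ n + r2 ^+ n + r3 ^+ n.
  apply: le_trans (lerD (lerD (ch1 n) (ch2 n)) (ch3 n)).
  pose ind (x y : R) : R := (x <= y)%R%:R.
  apply: (@le_trans _ _ (jointE pn an bn kn cn Wn (fun u1 u2 x1 s x2 y =>
    ind (chanV kn cn Wn u1 u2 x1 y) (exp (n%:R * (D1 - delta)) * out_u1u2 bn kn cn Wn u1 u2 y)
    + ind (chanV kn cn Wn u1 u2 x1 y) (exp (n%:R * (D2 - delta)) * out_u1 an bn kn cn Wn u1 y)
    + ind (chanV kn cn Wn u1 u2 x1 y) (exp (n%:R * (D3 - delta)) * out pn an bn kn cn Wn y)))).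
    apply: ler_jointE => // u1 u2 x1 s x2 y; rewrite /good /ind !ltNge.
    by do 3!case: (chanV _ _ _ _ _ _ _ <= _); rewrite /= -?natrD ler_nat.
  rewrite !jointED le_eqVlt; apply/orP; left; apply/eqP.
  congr (_ + _ + _); apply: jointE_tensor => t; rewrite /ind chanV_tensor
    ?out_u1u2_tensor ?out_u1_tensor ?out_tensor;
  by congr ((_ <= _ * _)%R%:R); apply: eq_bigr => i _; rewrite !ffunE.
have jk : jointE pn an bn kn cn Wn (fun u1 u2 x1 s x2 y =>
    (exp (- (n%:R * (D0 - delta))) * Qn s < kn u1 u2 s)%R%:R) <= r0 ^+ n.
  apply: le_trans (ch0 n).
  apply: (@le_trans _ _ (jointE pn an bn kn cn Wn (fun u1 u2 x1 s x2 y =>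
    (Qn s <= exp (n%:R * (D0 - delta)) * kn u1 u2 s)%R%:R))).
    apply: ler_jointE => // u1 u2 x1 s x2 y.
    rewrite ler_nat expRN ltr_pdivrMl ?exp_gt0 //.
    by case: ltP => // /ltW ->.
  rewrite le_eqVlt; apply/orP; left; apply/eqP; apply: jointE_tensor => t.
  by congr ((_ <= _ * _)%R%:R); apply: eq_bigr => i _; rewrite !ffunE.
by rewrite -?mulrA; move: jb jk le0 le1 le2 le3; lra.
Qed.

End SingleLetter.

(** * Rates *)

(** For a nonnegative rate the power is at least one, so rounding it up at most doubles it. *)
Lemma nmsg_bounds (Rt : R) n : 0 <= Rt ->
  exp (n%:R * (Rt * ln (IZR 2))) <= (nmsg Rt n)%:R
    <= 2 * exp (n%:R * (Rt * ln (IZR 2))).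
Proof.
move=> Rt_ge0; rewrite /nmsg /Rpower.
have -> : Rmult (Rmult (INR n) Rt) (ln (IZR 2)) = n%:R * (Rt * ln (IZR 2)).
  by rewrite !RealsE mulrA.
set x := exp _.
have x_ge1 : 1 <= x.
  by rewrite -[X in X <= _]exp_0 ler_exp !mulr_ge0 // ltW // ln2_gt0.
have [/RleP lo hi] := base_Int_part (Ropp x).
set z := Int_part _ in lo hi *.
have {}hi : - IZR z < x + 1.
  by move/RltP: hi; rewrite !RealsE => hi; have {}hi : -1 < IZR z - - x := hi; lra.
have {}lo : x <= - IZR z by move: lo; rewrite !RealsE => lo; lra.
have z_ge0 : Z.le Z0 (Z.opp z).
  by apply: le_IZR; rewrite opp_IZR; apply/RleP; rewrite !RealsE; lra.
rewrite -[(Z.to_nat _)%:R]INRE INR_IZR_INZ Z2Nat.id // opp_IZR RoppE.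
by apply/andP; split; lra.
Qed.

Lemma nmsg_gt0 (Rt : R) n : (0 < nmsg Rt n)%N.
Proof.
rewrite /nmsg; set x := Rpower _ _.
have x_gt0 : Rlt 0 x by apply: exp_pos.
have [lo _] := base_Int_part (Ropp x).
set z := Int_part _ in lo *.
have z_gt0 : Z.lt Z0 (Z.opp z).
  apply: lt_IZR; rewrite opp_IZR; move/RleP: lo; move/RltP: x_gt0.
  by rewrite !RealsE => x0 lo; apply/RltP; lra.
by apply/ssrnat.ltP; apply/Nat2Z.inj_lt; rewrite Z2Nat.id //; apply: Z.lt_le_incl.
Qed.

Lemma cv_geometric (rho C : R) (u : nat -> R) : 0 <= rho < 1 -> 0 < C ->
  (forall n, 0 <= u n <= C * rho ^+ n) -> Un_cv u 0.
Proof.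
move=> /andP[rho0 rho1] C_gt0 u_le eps /RltP eps_gt0.
have rho_abs : Rlt (Rabs rho) 1.
  by rewrite RabsE ger0_norm //; apply/RltP.
have [|N NP] := pow_lt_1_zero rho rho_abs (eps / C).
  by apply/RltP; rewrite divr_gt0.
exists N => n le_Nn; have /RltP := NP n le_Nn.
rewrite RdistE RabsE RpowE subr0 => lt_eps.
have /andP[u0 un] := u_le n.
apply/RltP; rewrite ger0_norm //; apply: le_lt_trans un _.
by rewrite -ltr_pdivlMl // mulrC; apply: le_lt_trans lt_eps; rewrite ler_norm.
Qed.

Lemma err_prob_ge0 (S X1 X2 Y : finType) (QS : S -> R)
    (W : X1 -> X2 -> S -> Y -> R) n Mc M1 (cd : code S X1 X2 Y n Mc M1) :
  prob QS -> (forall x1 x2 s, prob (W x1 x2 s)) -> 0 <= err_prob QS W cd.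
Proof.
move=> [Q0 _] pW; rewrite /err_prob.
rewrite rsumE; apply: sumr_ge0 => w _; rewrite rsumE; apply: sumr_ge0 => v _.
rewrite rsumE; apply: sumr_ge0 => s _; rewrite rsumE; apply: sumr_ge0 => y _.
rewrite !RealsE; apply: mulr_ge0; last by case: (_ == _).
rewrite !mulr_ge0 ?invr_ge0 //; first by apply: prodr_ge0.
by apply: prodr_ge0 => i _; case: (pW (enc1 cd w v i) (enc2 cd s w i) (s i)).
Qed.

(** The strict rate inequalities leave room for a list rate slightly above I(U2; S | U1) and for the
    threshold losses, so every term of [block_code] decays geometrically. *)
Lemma inner_region_achievable (S X1 X2 Y : finType) (QS : S -> R)
    (W : X1 -> X2 -> S -> Y -> R) r :
  prob QS -> (forall x1 x2 s, prob (W x1 x2 s)) ->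
  inner_region QS W r -> achievable QS W r.
Proof.
case: r => Rc R1 pQ pW [/= /RleP Rc_ge0 [/RleP R1_ge0]].
move=> [U1 [U2 [p [b [PU2 [PX2 [_ [_ [/is_pmfP pp [b_ch [PU2_ch [PX2_ch]]]]]]]]]]]].
have pb u1 : prob (b u1) by apply/is_pmfP; apply: b_ch.
have pPU2 u1 s : prob (PU2 u1 s) by apply/is_pmfP; apply: PU2_ch.
have pc u1 u2 s : prob (PX2 u1 u2 s) by apply/is_pmfP; apply: PX2_ch.
move=> [_ [/RltP lt1 [/RltP lt2 /RltP lt3]]].
set l2 := ln (IZR 2); have l2_gt0 : 0 < l2 := ln2_gt0.
move: lt1; rewrite -(ltr_pM2r l2_gt0) (cmi_x1 pQ pp pb pPU2 pc pW) => {}lt1.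
move: lt2; rewrite !RealsE -(ltr_pM2r l2_gt0) mulrBl.
rewrite (cmi_x1u2 pQ pp pb pPU2 pc pW) (cmi_u2s pQ pp pb pPU2 pc pW) opprK => {}lt2.
move: lt3; rewrite !RealsE -(ltr_pM2r l2_gt0) mulrBl mulrDl.
rewrite (mi_x1u1u2 pQ pp pb pPU2 pc pW) (cmi_u2s pQ pp pb pPU2 pc pW) opprK => {}lt3.
move: lt3 lt2 lt1; have := mean_llr_QS_le0 pQ pp pb pPU2 pc pW.
have := @block_code _ _ _ _ _ _ _ _ _ _ _ _ pQ pp pb pPU2 pc pW.
set D0 := mean_llr _ (fun _ => QS _) _.
set D1 := mean_llr _ _ (fun t => out_u1u2 _ _ _ _ _ _ _).
set D2 := mean_llr _ _ (fun t => out_u1 _ _ _ _ _ _ _).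
set D3 := mean_llr _ _ (fun t => out _ _ _ _ _ _ _).
move=> blk D0_le0 lt3 lt2 lt1.
(* A quarter of the smallest slack, in nats: one [d] is lost in the thresholds and two in the list
   rate. *)
pose d := Num.min (D1 - R1 * l2) (Num.min (D2 + D0 - R1 * l2) (D3 + D0 - Rc * l2 - R1 * l2)) / 4.
have d_gt0 : 0 < d.
  by rewrite divr_gt0 // !lt_min; apply/andP; split; [lra|apply/andP; split; lra].
have [d1 d2 d3] : [/\ 4 * d <= D1 - R1 * l2, 4 * d <= D2 + D0 - R1 * l2 &
    4 * d <= D3 + D0 - Rc * l2 - R1 * l2].
  by rewrite /d mulrC divfK ?pnatr_eq0 //; split; rewrite !ge_min !lexx ?orbT.
clearbody d; have [rho /andP[rho0 rho1] codeP] := blk d d_gt0.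
(* The list rate in bits; in nats it exceeds I(U2; S | U1), which is [- D0], by [2 * d]. *)
pose T := (2 * d - D0) / l2.
have T_ge0 : 0 <= T by rewrite divr_ge0 ?ltW //; lra.
have Tl2 : T * l2 = 2 * d - D0 by rewrite divfK // gt_eqF.
(* The constant 16 collects 2, 4 and 8 from rounding one, two and three message counts, and 1 each
   from [eps] and the covering term. *)
have exP n : exists cd : code S X1 X2 Y n (nmsg Rc n) (nmsg R1 n),
    err_prob QS W cd <= 4 * rho ^+ n + 16 * exp (- (d / 2)) ^+ n.
  (* With [eps] of exponent [- d / 2], the covering term has exponent [d - 2 * d + d / 2], which is
     again [- d / 2]. *)
  have eps_gt0 : 0 < exp (- (n%:R * (d / 2))) := exp_gt0 _.
  have [cd le_cd] := codeP n (nmsg Rc n) (nmsg R1 n) (nmsg T n) _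
    (nmsg_gt0 _ _) (nmsg_gt0 _ _) (nmsg_gt0 _ _) eps_gt0.
  exists cd; apply: le_trans le_cd _.
  have /andP[_ Mc_le] := nmsg_bounds n Rc_ge0.
  have /andP[_ M1_le] := nmsg_bounds n R1_ge0.
  have /andP[J_ge J_le] := nmsg_bounds n T_ge0.
  rewrite -/l2 Tl2 in Mc_le M1_le J_le J_ge.
  move: (nmsg Rc n) (nmsg R1 n) (nmsg T n) Mc_le M1_le J_le J_ge
    => Mc M1 J Mc_le M1_le J_le J_ge.
  have n_ge0 : 0 <= n%:R :> R by [].
  have en x y : x <= y -> exp (n%:R * x) <= exp (n%:R * y).
    by move=> le_xy; rewrite ler_exp ler_wpM2l.
  have t1 : M1%:R / exp (n%:R * (D1 - d)) <= 2 * exp (n%:R * (- (d / 2))).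
    rewrite ler_pdivrMr ?exp_gt0 // (le_trans M1_le) // -mulrA ler_pM2l // expM -mulrDr.
    by apply: en; lra.
  have t2 : (M1 * J)%:R / exp (n%:R * (D2 - d)) <= 4 * exp (n%:R * (- (d / 2))).
    rewrite ler_pdivrMr ?exp_gt0 // natrM (le_trans (ler_pM _ _ M1_le J_le)) //.
    rewrite mulrACA -natrM -!mulrA ler_pM2l // !expM -!mulrDr.
    by apply: en; lra.
  have t3 : (Mc * M1 * J)%:R / exp (n%:R * (D3 - d)) <= 8 * exp (n%:R * (- (d / 2))).
    rewrite ler_pdivrMr ?exp_gt0 // !natrM.
    rewrite (le_trans (ler_pM _ _ (ler_pM _ _ Mc_le M1_le) J_le)) ?mulr_ge0 //.
    have -> x y z : 2 * x * (2 * y) * (2 * z) = 8 * (x * y * z) :> R by ring.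
    rewrite -(mulrA 8) ler_pM2l // !expM -!mulrDr.
    by apply: en; lra.
  have t4 : exp (- (n%:R * (D0 - d))) / (4 * exp (- (n%:R * (d / 2))) * J%:R)
      <= exp (n%:R * (- (d / 2))).
    have J_gt0 : 0 < J%:R :> R by apply: lt_le_trans J_ge; apply: exp_gt0.
    rewrite ler_pdivrMr ?mulr_gt0 //.
    apply: (@le_trans _ _ (exp (n%:R * - (d / 2)) * (1 * exp (- (n%:R * (d / 2))) * exp (n%:R * (2 * d - D0))))).
      by rewrite mul1r -!mulrN !expM -!mulrDr; apply: en; lra.
    rewrite ler_pM2l ?exp_gt0 //; apply: ler_pM => //.
    - by rewrite mul1r ltW.
    - by rewrite ltW // exp_gt0.
    - by rewrite ler_pM2r // ler1n.
  have -> : exp (- (d / 2)) ^+ n = exp (n%:R * - (d / 2)).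
    by rewrite expRX mulr_natl.
  move: t1 t2 t3 t4; rewrite -(mulrN n%:R (d / 2)).
  set A1 := _ / exp (_ * (D1 - d)); set A2 := _ / exp (_ * (D2 - d)).
  set A3 := _ / exp (_ * (D3 - d)); set A0 := exp (- _) / _.
  lra.
exists (fun n => projT1 (cid (exP n))).
pose rho' := Num.max rho (exp (- (d / 2))).
have e_lt1 : exp (- (d / 2)) < 1.
  by rewrite -[X in _ < X]exp_0 ltNge ler_exp -ltNge; change (- (d / 2) < 0); lra.
have e_gt0 := exp_gt0 (- (d / 2)).
have rho'_ge0 : 0 <= rho' by rewrite le_max rho0.
apply: (@cv_geometric rho' 20%R) => [||n].
- by rewrite rho'_ge0 gt_max rho1.
- by rewrite ltr0n.
apply/andP; split; first exact: err_prob_ge0.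
apply: le_trans (projT2 (cid (exP n))) _.
have leX x : 0 <= x -> x <= rho' -> x ^+ n <= rho' ^+ n.
  by move=> x0 le_x; rewrite lerXn2r ?nnegrE.
have l1 : rho ^+ n <= rho' ^+ n by rewrite leX // le_max lexx.
have l3 : exp (- (d / 2)) ^+ n <= rho' ^+ n by apply: leX; [exact: ltW|rewrite le_max lexx orbT].
by lra.
Qed.

(** Closure is monotone: the approximating pair in the inner region is itself achievable. *)
Theorem theorem1 (S X1 X2 Y : finType) (QS : S -> R)
    (W : X1 -> X2 -> S -> Y -> R) :
  is_pmf QS ->
  (forall x1 x2 s, is_pmf (W x1 x2 s)) ->
  forall r : R * R,
    closure2 (inner_region QS W) r -> capacity_region QS W r.
Proof.
move=> /is_pmfP pQ pW r in_cl eps eps_gt0.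
have [r' [in_r' close]] := in_cl eps eps_gt0.
exists r'; split=> //; apply: inner_region_achievable in_r' => // x1 x2 s.
exact/is_pmfP.
Qed.
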